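(* Let $n\geq 1$ and $k \geq 0$ be integers and let $f,g \in C^{2k}_{buc}(\mathbb{C}^n)$. Then $$\sum_{\substack{\alpha \in \mathbb{N}_0^n \\ |\alpha| \leq k}} \frac{(-t)^{|\alpha|}}{\alpha !} \left((\partial^{\alpha}f)(\bar{\partial}^{\alpha}g)\right)^{(t)} = \sum_{\substack{\alpha \in \mathbb{N}_0^n \\ |\alpha| \leq k}} \frac{t^{|\alpha|}}{\alpha !} \left(\bar{\partial}^{\alpha}f^{(t)}\right)\left(\partial^{\alpha}g^{(t)}\right) + o(t^k)$$ uniformly on $\mathbb{C}^n$ as $t \to 0$ ($t>0$); that is, $t^{-k}$ times the supremum over $\mathbb{C}^n$ of the absolute value of the difference of the two sums tends to $0$ as $t\to 0$.
   Context: Multi-indices: for $\alpha \in \mathbb{N}_0^n$, $|\alpha| = \alpha_1+\dots+\alpha_n$, $\alpha! = \alpha_1!\cdots\alpha_n!$, $\partial^\alpha = \frac{\partial^{|\alpha|}}{\partial z_1^{\alpha_1}\cdots\partial z_n^{\alpha_n}}$ and $\bar\partial^\alpha = \frac{\partial^{|\alpha|}}{\partial \bar z_1^{\alpha_1}\cdots\partial \bar z_n^{\alpha_n}}$ (Wirtinger derivatives on $\mathbb{C}^n \cong \mathbb{R}^{2n}$). $C^{2k}_{buc}(\mathbb{C}^n)$ is the set of functions $f\colon\mathbb{C}^n\to\mathbb{C}$ that are $2k$-times continuously differentiable (in the real sense) and all of whose partial derivatives up to order $2k$ (including order $0$) are bounded and uniformly continuous. For $t>0$ and $h\in L^\infty(\mathbb{C}^n)$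 the heat transform of $h$ is the function $h^{(t)}\colon\mathbb{C}^n\to\mathbb{C}$, $$h^{(t)}(z) = \frac{1}{(t\pi)^n}\int_{\mathbb{C}^n} h(w) e^{-\frac1t|w-z|^2}\,\mathrm{d}w = \frac{1}{\pi^n}\int_{\mathbb{C}^n} h(\sqrt t\,w+z)e^{-|w|^2}\,\mathrm{d}w,$$ where $\mathrm{d}w$ is Lebesgue measure on $\mathbb{C}^n$. The expression $\partial^\alpha g^{(t)}$ denotes the derivative $\partial^\alpha$ applied to the function $g^{(t)}$, and similarly for $\bar\partial^\alpha f^{(t)}$. *)

(* Defs.v *)
From HB Require Import structures.
From mathcomp Require Import all_boot all_order all_algebra.
From mathcomp Require Import complex.
From mathcomp Require Import all_classical all_reals all_analysis.
Import Order.TTheory GRing.Theory Num.Theory.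
Import numFieldNormedType.Exports.

Set Implicit Arguments.
Unset Strict Implicit.
Unset Printing Implicit Defensive.

Local Open Scope classical_set_scope.
Local Open Scope ring_scope.
Local Open Scope complex_scope.

Section PowerMeasure.
Local Open Scope ereal_scope.
Context d (T : measurableType d) (R : realType).
Variable mu : {sigma_finite_measure set T -> \bar R}.

Definition pair_cons n (p : T * n.-tuple T) : n.+1.-tuple T :=
  [the n.+1.-tuple T of p.1 :: p.2].

Lemma measurable_pair_cons n : measurable_fun setT (@pair_cons n).
Proof. exact: measurable_cons. Qed.

Definition power_measureS n
    (nu : {sigma_finite_measure set (n.-tuple T) -> \bar R}) :
    set (n.+1.-tuple T) -> \bar R :=
  pushforward (mu \x nu) (@pair_cons n).

Section PowerMeasureS.
Context n (nu : {sigma_finite_measure set (n.-tuple T) -> \bar R}).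

Let pm0 : power_measureS nu set0 = 0.
Proof. by rewrite /power_measureS /pushforward preimage_set0 measure0. Qed.

Let pm_ge0 A : 0 <= power_measureS nu A.
Proof. exact: (measure_ge0 (mu \x nu)). Qed.

Let pm_sigma_additive : semi_sigma_additive (power_measureS nu).
Proof.
move=> F mF tF mUF; rewrite /power_measureS /pushforward preimage_bigcup.
have mc := @measurable_pair_cons n.
apply: measure_semi_sigma_additive.
- by move=> i; rewrite -[X in measurable X]setTI; exact: mc.
- apply/trivIsetP => /= i j _ _ ij; rewrite -preimage_setI.
  by move/trivIsetP : tF => /(_ _ _ _ _ ij) ->//; rewrite preimage_set0.
- by rewrite -preimage_bigcup -[X in measurable X]setTI; exact: mc.
Qed.

HB.instance Definition _ := isMeasure.Build _ _ _ (power_measureS nu)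
  pm0 pm_ge0 pm_sigma_additive.

Let pm_sigma_finite : sigma_finite setT (power_measureS nu).
Proof.
have /sigma_finiteP[F [TF ndF Foo]] := sigma_finiteT mu.
have /sigma_finiteP[G [TG ndG Goo]] := sigma_finiteT nu.
pose h (x : n.+1.-tuple T) := (thead x, [tuple of behead x]).
have hK : cancel (@pair_cons n) h.
  by case=> a s; congr pair; exact/val_inj.
have mh : measurable_fun setT h.
  by apply/measurable_fun_pair; [exact: (measurable_tnth ord0)|
    exact: measurable_behead].
exists (fun i => h @^-1` (F i `*` G i)).
  rewrite -preimage_bigcup (_ : \bigcup_i _ = setT) ?preimage_setT//.
  rewrite -setXTT TF TG predeqE => -[x y]; split.
    by move=> [i _ []/= ? ?]; split; exists i.
  move=> [/= [i _ Fix] [j _ Gjy]]; exists (maxn i j) => //; split.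
  - by move: x Fix; exact/subsetPset/ndF/leq_maxl.
  - by move: y Gjy; exact/subsetPset/ndG/leq_maxr.
move=> i; have [mFi Fioo] := Foo i; have [mGi Gioo] := Goo i; split.
  by rewrite -[X in measurable X]setTI; apply: mh => //; exact: measurableX.
rewrite /power_measureS /pushforward -comp_preimage.
rewrite (_ : h \o _ = id); last by apply/funext => x /=; rewrite hK.
by rewrite preimage_id product_measure1E// lte_mul_pinfty// ge0_fin_numE.
Qed.

HB.instance Definition _ := Measure_isSigmaFinite.Build _ _ _
  (power_measureS nu) pm_sigma_finite.

End PowerMeasureS.

Fixpoint power_measure n : {sigma_finite_measure set (n.-tuple T) -> \bar R} :=
  match n with
  | 0 => \d_ [tuple]
  | n'.+1 => power_measureS (power_measure n')
  end.

(* Together with sigma-finiteness, this characterises the product measure. *)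
Lemma power_measure_box n (A : 'I_n -> set T) :
  (forall i, measurable (A i)) ->
  power_measure n [set x | forall i, A i (tnth x i)] = \prod_(i < n) mu (A i).
Proof.
elim: n A => [|n IHn] A mA.
  rewrite big_ord0 /= diracE mem_set//= => -[].
  by [].
rewrite big_ord_recl -IHn//= /power_measureS /pushforward.
rewrite -product_measure1E//; last first.
  rewrite (_ : mkset _ =
    \bigcap_(i in [set: 'I_n]) ((@tnth n T ^~ i) @^-1` A (lift ord0 i))).
    apply: fin_bigcap_measurable => // i _.
    by rewrite -[X in measurable X]setTI; exact: measurable_tnth.
  by apply/seteqP; split=> [x Ax i _|x Ax i]; [exact: Ax|exact: (Ax i)].
congr (_ _); apply/seteqP; split=> [[a s] As|[a s] [/= Aa As] i] /=.
  by split=> [|i]; [exact: (As ord0)|have := As (lift ord0 i); rewrite tnthS].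
by case: (unliftP ord0 i) => [j ->|->]; rewrite ?tnthS//; exact: As.
Qed.

End PowerMeasure.

Definition lebesgue_power (R : realType) (m : nat) :
    {sigma_finite_measure set (m.-tuple (measurableTypeR R)) -> \bar R} :=
  power_measure (@lebesgue_measure R) m.

Section HeatTransform.
Context (R : realType) (n : nat).
Local Notation C := R[i].
Local Notation Cn := 'rV[R[i]]_n.

Definition enorm (z : Cn) : R :=
  Num.sqrt (\sum_(j < n) Normc.normc (z ord0 j) ^+ 2).

(* C^n is identified with R^(2n) through (x_1..x_n, y_1..y_n) |-> x + i y. *)
Definition Cn_of_tuple (w : (n + n).-tuple (measurableTypeR R)) : Cn :=
  \row_(j < n) (tnth w (lshift n j) +i* tnth w (rshift n j)).

Definition Cn_integral (h : Cn -> C) : C :=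
  (\int[lebesgue_power R (n + n)]_w complex.Re (h (Cn_of_tuple w))) +i*
  (\int[lebesgue_power R (n + n)]_w complex.Im (h (Cn_of_tuple w))).

Definition heat_transform (t : R) (h : Cn -> C) (z : Cn) : C :=
  ((t * pi) ^- n)%:C *
  Cn_integral (fun w => h w * (expR (- (enorm (w - z) ^+ 2 / t)))%:C).

(* (j, false) is the coordinate x_j and (j, true) the coordinate y_j. *)
Definition real_dir (d : 'I_n * bool) : Cn :=
  (if d.2 then 'i%C else 1) *: delta_mx ord0 d.1.

Definition along (h : Cn -> C) (d : 'I_n * bool) (z : Cn) (s : R) : C :=
  h (z + s%:C *: real_dir d).

Definition rpartial_ex (h : Cn -> C) (d : 'I_n * bool) (z : Cn) : Prop :=
  derivable (fun s => complex.Re (along h d z s)) 0 1 /\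
  derivable (fun s => complex.Im (along h d z s)) 0 1.

Definition rpartial (d : 'I_n * bool) (h : Cn -> C) (z : Cn) : C :=
  derive1 (fun s => complex.Re (along h d z s)) 0 +i*
  derive1 (fun s => complex.Im (along h d z s)) 0.

Definition rpartials (s : seq ('I_n * bool)) (h : Cn -> C) : Cn -> C :=
  foldr rpartial h s.

Definition bounded_on_Cn (h : Cn -> C) : Prop :=
  exists M : R, forall z, Normc.normc (h z) <= M.

Definition unif_cont_on_Cn (h : Cn -> C) : Prop :=
  forall e : R, 0 < e -> exists2 r : R, 0 < r &
    forall z w, enorm (z - w) < r -> Normc.normc (h z - h w) < e.

(* Continuity of the partial derivatives, required for h to be of class C^m in
   the real sense, is subsumed by their uniform continuity. *)
Definition C_buc (m : nat) (h : Cn -> C) : Prop :=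
  forall s : seq ('I_n * bool), (size s <= m)%N ->
    [/\ (size s < m)%N -> forall d z, rpartial_ex (rpartials s h) d z,
        bounded_on_Cn (rpartials s h)
      & unif_cont_on_Cn (rpartials s h)].

Definition wirtinger (j : 'I_n) (h : Cn -> C) (z : Cn) : C :=
  2^-1 * (rpartial (j, false) h z - 'i%C * rpartial (j, true) h z).

Definition wirtinger_bar (j : 'I_n) (h : Cn -> C) (z : Cn) : C :=
  2^-1 * (rpartial (j, false) h z + 'i%C * rpartial (j, true) h z).

Definition multi_deg (a : 'I_n -> nat) : nat := (\sum_(j < n) a j)%N.

Definition multi_fact (a : 'I_n -> nat) : nat := (\prod_(j < n) (a j)`!)%N.

Definition mwirtinger (a : 'I_n -> nat) (h : Cn -> C) : Cn -> C :=
  foldr (fun j => iter (a j) (wirtinger j)) h (enum 'I_n).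

Definition mwirtinger_bar (a : 'I_n -> nat) (h : Cn -> C) : Cn -> C :=
  foldr (fun j => iter (a j) (wirtinger_bar j)) h (enum 'I_n).

(* The sum over all multi-indices a with |a| <= k: the components of such an a
   are at most k, so a is determined by a unique function 'I_n -> 'I_k.+1. *)
Definition multi_sum (k : nat) (F : ('I_n -> nat) -> C) : C :=
  \sum_(a : {ffun 'I_n -> 'I_k.+1} | (multi_deg (fun j => a j) <= k)%N)
     F (fun j => a j).

End HeatTransform.

(* Main.v *)
From HB Require Import structures.
From mathcomp Require Import all_boot all_order all_algebra.
From mathcomp Require Import complex.
From mathcomp Require Import all_classical all_reals all_analysis.
From mathcomp Require Import measurable_realfun.
From mathcomp Require Import zify ring lra.
Require Import Defs.
Import Order.TTheory GRing.Theory Num.Theory.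
Import numFieldNormedType.Exports.

Set Implicit Arguments.
Unset Strict Implicit.
Unset Printing Implicit Defensive.

Local Open Scope classical_set_scope.
Local Open Scope ring_scope.

(** Write h^(t) for the heat transform, d_j and db_j for the two Wirtinger
    derivatives, and L = sum_j d_j db_j for one quarter of the Laplacian. Two
    facts about the heat transform are used: h^(t) tends to h uniformly as t
    tends to 0, and d/dt h^(t) = (L h)^(t) ([cplx_heat_cvg0] and
    [is_cderive_cplx_heat]).

    Let F_i and G_i be the sums over all words w of length i of
    ((d_w f) (db_w g))^(t) and of (db_w f)^(t) (d_w g)^(t). As i! / a! words have
    the letter counts a, the two sides of the theorem are the sums of
    (-t)^i / i! F_i and of t^i / i! G_i over i <= k ([multi_sum_word]). Let D_k
    be their difference. The product rule
      L (f g) = (L f) g + f (L g) + sum_j d_j f db_j g + sum_j db_j f d_j g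
    yields
      F_i(f, g)' = F_i(L f, g) + F_i(f, L g) + F_{i+1}(f, g)
                   + sum_j F_i(db_j f, d_j g),
      G_i(f, g)' = G_i(L f, g) + G_i(f, L g).
    In the first alternating sum the derivatives of the coefficients cancel the
    terms F_{i+1}; in the second sum they supply the missing sum over j. Hence,
    with Z = (-1)^(k+1) F_{k+1} - G_{k+1},
      D_k(f, g)' = D_k(L f, g) + D_k(f, L g) + sum_j D_k(db_j f, d_j g)
                   - t^k / k! Z,
      D_{k+1} = D_k + t^(k+1) / (k+1)! Z
    ([defect_is_cderive], [defectS]). The theorem is proved by induction on k
    ([defect_littleo]): if f and g are of class 2k+2, then the functions on the
    right are of class 2k, so the defects on the right are o(t^k); and Z
    converges uniformly to some Z_0. Thus D_k + t^(k+1) / (k+1)! Z_0 vanishes at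
    t = 0 and has a derivative of size o(t^k), so it is o(t^(k+1)) by the mean
    value theorem, and it differs from D_{k+1} by t^(k+1) / (k+1)! (Z_0 - Z).

    The heat equation itself is reduced to one real variable. By Fubini, the
    heat transform is a composition of Gaussian averages along the 2n coordinate
    directions ([Rintegral_place], [heat_transformE]). Each of them is an average
    of translates, so it respects bounds, moduli of continuity and partial
    derivatives; its time derivative comes from differentiation under the
    integral and integration by parts ([is_derive_gauss_mean_dilation]), and
    compositions are differentiated one factor at a time
    ([is_derive_heat_along]). *)

(** * The Gaussian mean on the line *)

Section GaussianMean.
Context {R : realType}.
Notation mu := (@lebesgue_measure R).
Implicit Types (phi psi : R -> R) (M : R).

Definition gauss_density (x : R) : R := gauss_fun x / Num.sqrt pi.

Definition gauss_integrable phi :=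
  mu.-integrable setT (EFin \o (fun x => phi x * gauss_density x)).

Definition gauss_mean phi : R := \int[mu]_x (phi x * gauss_density x).

Lemma sqrt_pi_gt0 : 0 < Num.sqrt pi :> R.
Proof. by rewrite sqrtr_gt0 pi_gt0. Qed.

Lemma gauss_density_ge0 x : 0 <= gauss_density x.
Proof. by rewrite divr_ge0 ?gauss_fun_ge0 ?sqrtr_ge0. Qed.

Lemma continuous_gauss_density : continuous gauss_density.
Proof. by move=> x; apply: cvgMl; exact: continuous_gauss_fun. Qed.

Lemma measurable_gauss_density : measurable_fun setT gauss_density.
Proof. by apply: continuous_measurable_fun; exact: continuous_gauss_density. Qed.

Lemma gauss_integrable1 : gauss_integrable (fun=> 1).
Proof.
rewrite /gauss_integrable (_ : (EFin \o _) =
    (fun x => ((Num.sqrt pi)^-1)%:E * (gauss_fun x)%:E)%E); last first.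
  by apply/funext => x /=; rewrite mul1r /gauss_density mulrC EFinM.
by apply: integrableZl => //; exact: integrableT_gauss.
Qed.

Lemma gauss_mean1 : gauss_mean (fun=> 1) = 1.
Proof.
rewrite /gauss_mean /Rintegral.
under eq_integral do rewrite mul1r /gauss_density mulrC EFinM.
rewrite integralZl//; last exact: integrableT_gauss.
by rewrite integralT_gauss -EFinM /= mulVf // gt_eqF // sqrt_pi_gt0.
Qed.

Lemma gauss_integrable_le phi psi : measurable_fun setT phi ->
  (forall x, `|phi x| <= psi x) -> gauss_integrable psi -> gauss_integrable phi.
Proof.
move=> mphi le_phi; apply: le_integrable => //.
  apply/measurable_EFinP; apply: measurable_funM => //.
  exact: measurable_gauss_density.
move=> x _ /=; rewrite lee_fin !normrM.
by rewrite ler_wpM2r// (le_trans (le_phi x))// ler_norm.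
Qed.

Lemma gauss_integrableZ a phi :
  gauss_integrable phi -> gauss_integrable (fun x => a * phi x).
Proof.
move=> /(@integrableZl _ _ _ mu setT measurableT a) h.
rewrite /gauss_integrable; apply: eq_integrable h => // x _ /=; by rewrite -EFinM mulrA.
Qed.

Lemma gauss_integrableD phi psi : gauss_integrable phi ->
  gauss_integrable psi -> gauss_integrable (fun x => phi x + psi x).
Proof.
move=> h1 h2; have h := integrableD measurableT h1 h2.
rewrite /gauss_integrable; apply: eq_integrable h => // x _ /=; by rewrite -EFinD mulrDl.
Qed.

Lemma gauss_meanZ a phi : gauss_integrable phi ->
  gauss_mean (fun x => a * phi x) = a * gauss_mean phi.
Proof.
move=> h; rewrite /gauss_mean -RintegralZl//.
by apply: eq_Rintegral => x _; rewrite mulrA.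
Qed.

Lemma gauss_meanD phi psi : gauss_integrable phi -> gauss_integrable psi ->
  gauss_mean (fun x => phi x + psi x) = gauss_mean phi + gauss_mean psi.
Proof.
move=> h1 h2; rewrite /gauss_mean -RintegralD//.
by apply: eq_Rintegral => x _; rewrite mulrDl.
Qed.

Lemma gauss_integrable_cst a : gauss_integrable (fun=> a).
Proof.
by have := gauss_integrableZ a gauss_integrable1; rewrite mulr1.
Qed.

Lemma gauss_mean_cst a : gauss_mean (fun=> a) = a.
Proof.
have := gauss_meanZ a gauss_integrable1.
by rewrite gauss_mean1 mulr1.
Qed.

Lemma le_gauss_mean phi psi : gauss_integrable phi -> gauss_integrable psi ->
  (forall x, phi x <= psi x) -> gauss_mean phi <= gauss_mean psi.
Proof.
move=> h1 h2 le12; apply: le_Rintegral => // x _.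
by rewrite ler_wpM2r// gauss_density_ge0.
Qed.

Lemma norm_gauss_mean_le phi psi : gauss_integrable phi ->
  gauss_integrable psi -> (forall x, `|phi x| <= psi x) ->
  `|gauss_mean phi| <= gauss_mean psi.
Proof.
move=> h1 h2 le12; rewrite ler_norml; apply/andP; split; last first.
  by apply: le_gauss_mean => // x; rewrite (le_trans (ler_norm _)).
rewrite -mulN1r -gauss_meanZ//; apply: le_gauss_mean => // [|x].
  exact: gauss_integrableZ.
by rewrite mulN1r; have := le12 x; rewrite ler_norml => /andP[].
Qed.

Lemma gauss_integrable_bounded phi M : continuous phi ->
  (forall x, `|phi x| <= M) -> gauss_integrable phi.
Proof.
move=> cphi leM; apply: (gauss_integrable_le _ leM).
  exact: continuous_measurable_fun.
exact: gauss_integrable_cst.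
Qed.

(** Twice the unnormalised normal density exp (- x^2 / 2) dominates
    x^2 exp (- x^2). *)
Lemma gauss_integrable_sqr : gauss_integrable (fun x => x ^+ 2).
Proof.
pose c : R := 2 * Num.sqrt (2 * pi) / Num.sqrt pi.
have hi : mu.-integrable setT (fun x => (c%:E * (normal_pdf 0 1 x)%:E)%E).
  by apply: integrableZl => //; exact: integrable_normal_pdf.
apply: le_integrable hi => //.
  apply/measurable_EFinP; apply: measurable_funM.
    exact: (measurable_funX 2 (@measurable_id _ _ _)).
  exact: measurable_gauss_density.
move=> x _ /=; rewrite lee_fin.
rewrite ger0_norm; last by apply: mulr_ge0; [exact: sqr_ge0|exact: gauss_density_ge0].
apply: le_trans (ler_norm _).
rewrite normal_pdfE ?oner_neq0// /normal_peak /normal_fun subr0 expr1n.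
rewrite /c mul1r -[pi *+ 2]mulr_natl.
have s2 : 0 < Num.sqrt (2 * pi) :> R by rewrite sqrtr_gt0 mulr_gt0 ?pi_gt0.
have -> : 2 * Num.sqrt (2 * pi) / Num.sqrt pi *
   ((Num.sqrt (2 * pi))^-1 * expR (- x ^+ 2 / 2))
  = 2 * expR (- x ^+ 2 / 2) / Num.sqrt pi.
  field.
  by rewrite !gt_eqF// sqrt_pi_gt0.
rewrite /gauss_density mulrA ler_wpM2r ?invr_ge0 ?sqrtr_ge0// /gauss_fun.
have e0 : 0 < expR (- x ^+ 2 / 2) by exact: expR_gt0.
have -> : expR (- x ^+ 2) = expR (- x ^+ 2 / 2) * expR (- x ^+ 2 / 2).
  by rewrite -expRD; congr expR; field.
have e1 : expR (x ^+ 2 / 2) * expR (- x ^+ 2 / 2) = 1.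
  by rewrite -expRD -expR0; congr expR; field.
rewrite mulrA ler_wpM2r ?(ltW e0)//.
have := expR_ge1Dx (x ^+ 2 / 2).
rewrite -(ler_pM2r e0) e1; have := ltW e0; lra.
Qed.

End GaussianMean.

(** * Integration by parts and the heat equation on the line *)

Section GaussianIntegrationByParts.
Context {R : realType}.
Notation mu := (@lebesgue_measure R).
Implicit Types (phi psi : R -> R) (M : R).

Lemma is_derive_gauss_density (x : R) :
  is_derive x 1 gauss_density (- (2 * x) * gauss_density x).
Proof.
rewrite /gauss_density.
have h : is_derive x 1 (fun y : R => - y ^+ 2) (- (2 * x)).
  apply: is_derive_eq; rewrite /GRing.scale /=. ring.
have h2 : is_derive x 1 (@gauss_fun R) (- (2 * x) * gauss_fun x).
  rewrite mulrC; exact: (@is_derive1_comp _ expR (fun y : R => - y ^+ 2)).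
have -> : (fun x : R => gauss_fun x / Num.sqrt pi) = (Num.sqrt pi)^-1 \*: (@gauss_fun R).
  by apply/funext => y /=; rewrite mulrC.
by apply: is_derive_eq; rewrite /= /GRing.scale /=; ring.
Qed.

Lemma cvg_gauss_density : gauss_density n%:R @[n --> \oo] --> (0 : R).
Proof.
rewrite -[X in _ --> X](mul0r (Num.sqrt pi)^-1).
apply: cvgMl; exact: (cvg_comp _ _ (@cvgr_idn R) cvg_gauss_fun).
Qed.

Lemma gauss_density_even (x : R) : gauss_density (- x) = gauss_density x.
Proof. by rewrite /gauss_density /gauss_fun sqrrN. Qed.

Lemma is_derive_continuous phi phi' :
  (forall x : R, is_derive x 1 phi (phi' x)) -> continuous phi.
Proof.
by move=> dphi x; apply/differentiable_continuous/derivable1_diffP; have := dphi x.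
Qed.

Lemma gauss_integrable_id_mul phi M : continuous phi ->
  (forall x, `|phi x| <= M) -> gauss_integrable (fun x => x * phi x).
Proof.
move=> cphi phiM.
have hi : gauss_integrable (fun x : R => `|M| * (1 + x ^+ 2)).
  apply/gauss_integrableZ/gauss_integrableD; first exact: gauss_integrable1.
  exact: gauss_integrable_sqr.
apply: gauss_integrable_le hi => [|x].
  apply: measurable_funM => //; exact: continuous_measurable_fun.
rewrite normrM mulrC ler_pM//.
  by rewrite (le_trans (phiM x))// ler_norm.
have [/ltW x1|x1] := ltP `|x| 1; first by rewrite (le_trans x1)// lerDl sqr_ge0.
rewrite -[x ^+ 2]real_normK ?num_real// expr2.
by rewrite (le_trans (ler_peMl _ x1))// lerDr.
Qed.

Lemma is_derive_under_Rintegral (f df : R -> R -> R) (G : R -> R) (a : R) :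
  (forall r, mu.-integrable setT (EFin \o f r)) ->
  (forall r x : R, is_derive r 1 (f ^~ x) (df r x)) ->
  mu.-integrable setT (EFin \o G) -> (forall r x, `|df r x| <= G x) ->
  is_derive a 1 (fun r => \int[mu]_x f r x) (\int[mu]_x df a x).
Proof.
move=> intf hdf intG dfG.
have G0 x : 0 <= G x by exact: le_trans (dfG 0 x).
have Ia : `]a - 1, a + 1[%classic a by rewrite /= in_itv /=; lra.
have der (r x : R) : `]a - 1, a + 1[%classic r -> setT x -> derivable (f ^~ x) r 1.
  by move=> _ _; have := hdf r x.
have bd (r x : R) : `]a - 1, a + 1[%classic r -> setT x -> `|partial1of2 f r x| <= G x.
  by move=> _ _; rewrite partial1of2E derive_val.
apply: DeriveDef.
  exact: (@derivable_under_integral R _ _ mu f setT measurableT a _ _ Ia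
    (fun r _ => intf r) der G G0 intG bd).
rewrite -derive1E (@differentiation_under_integral R _ _ mu f setT measurableT a _ _ Ia
    (fun r _ => intf r) der G G0 intG bd).
by apply: eq_Rintegral => x _; rewrite partial1of2E derive_val.
Qed.

Lemma cvg_Rintegral_itv (f : R -> R) : mu.-integrable setT (EFin \o f) ->
  \int[mu]_(x in `[- n%:R, n%:R]) f x @[n --> \oo] --> \int[mu]_x f x.
Proof.
move=> intf.
pose f_ n : R -> \bar R := EFin \o (f \_ `[- n%:R, n%:R]).
have mf : measurable_fun setT f.
  by apply/measurable_EFinP; exact: measurable_int intf.
have mf_ n : measurable_fun setT (f_ n).
  apply/measurable_EFinP; apply/(measurable_restrictT _ _).1 => //.
  exact: measurable_funS mf.
have intabs : mu.-integrable setT (fun x => `|f x|%:E).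
  exact: integrable_norm.
have fcvg : {ae mu, forall x, setT x -> f_ n x @[n --> \oo] --> (EFin \o f) x}.
  apply: aeW => x _ /=; apply: cvg_near_cst; near=> n.
  rewrite /f_ /= patchE ifT// inE /= in_itv /= -ler_norml.
  near: n; exact: nbhs_infty_ger.
have fle : {ae mu, forall x n, setT x -> (`|f_ n x| <= `|f x|%:E)%E}.
  apply: aeW => x n _; rewrite /f_ /= lee_fin patchE.
  by case: ifP => // _; rewrite normr0.
have mEf := measurable_int mu intf.
have [_ _ h] := @dominated_convergence _ _ _ mu setT measurableT f_
  (EFin \o f) _ mf_ mEf fcvg intabs fle.
have -> : (fun n => \int[mu]_(x in `[- n%:R, n%:R]) f x) =
    fine \o (fun n => \int[mu]_x f_ n x)%E.
  by apply/funext => n; rewrite Rintegral_mkcond.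
apply: fine_cvg; rewrite fineK; last exact: integrable_fin_num.
exact: h.
Unshelve. all: by end_near. Qed.

(** Integration by parts against a density whose derivative is -2x times
    itself; on [-n, n] the boundary terms vanish in the limit, because a
    bounded function times the density does. *)
Lemma gauss_mean_id_mul phi phi' M :
  (forall x : R, is_derive x 1 phi (phi' x)) -> continuous phi' ->
  (forall x, `|phi x| <= M) -> (forall x, `|phi' x| <= M) ->
  gauss_mean (fun x => x * phi x) = 2^-1 * gauss_mean phi'.
Proof.
move=> dphi cphi' phiM phi'M.
have cphi := is_derive_continuous dphi.
have i1 := gauss_integrable_bounded cphi' phi'M.
have i2 := gauss_integrable_id_mul cphi phiM.
pose F x := phi x * gauss_density x.
pose f x := (phi' x + (- 2) * (x * phi x)) * gauss_density x.
have dF (x : R) : is_derive x 1 F (f x).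
  have dg := is_derive_gauss_density x.
  apply: is_derive_eq; rewrite /GRing.scale /= /f; ring.
have intf : mu.-integrable setT (EFin \o f).
  by apply: gauss_integrableD => //; exact: gauss_integrableZ.
suff f0 : \int[mu]_x f x = 0.
  have : gauss_mean (fun x => phi' x + (- 2) * (x * phi x)) = 0 by exact: f0.
  rewrite gauss_meanD//; last exact: gauss_integrableZ.
  rewrite gauss_meanZ//; lra.
have cf : continuous f.
  move=> x; apply: cvgM; last exact: continuous_gauss_density.
  apply: cvgD; first exact: cphi'.
  by apply: cvgMr; apply: cvgM => //; exact: cphi.
have FTC n : (0 < n)%N ->
    \int[mu]_(x in `[- n%:R, n%:R]) f x = F n%:R - F (- n%:R).
  move=> n0; rewrite /Rintegral (@continuous_FTC2 _ f F)//.
  - by rewrite gtrN ?ltr0n.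
  - exact: continuous_subspaceT.
  - split=> [x _||].
    + by have := dF x.
    + by apply: cvg_at_right_filter; exact: (is_derive_continuous dF).
    + by apply: cvg_at_left_filter; exact: (is_derive_continuous dF).
  - by move=> x _; rewrite derive1E derive_val.
have lim0 : \int[mu]_(x in `[- n%:R, n%:R]) f x @[n --> \oo] --> (0 : R).
  have hM : (M + M) * gauss_density n%:R @[n --> \oo] --> (0 : R).
    by rewrite -[X in _ --> X](mulr0 (M + M)); apply: cvgMr; exact: cvg_gauss_density.
  apply: norm_cvg0; apply: (@squeeze_cvgr _ _ _ _ (fun=> 0) _ _ _ _ _ hM) => //; last first.
    exact: cvg_cst.
  near=> n; rewrite normr_ge0 /= FTC; last by near: n; exact: nbhs_infty_gt.
  rewrite (le_trans (ler_normB _ _))// /F gauss_density_even.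
  rewrite !(normrM (phi _) (gauss_density _)) (ger0_norm (gauss_density_ge0 _)).
  by rewrite mulrDl lerD// ler_wpM2r// gauss_density_ge0.
by apply: (cvg_unique _ (cvg_Rintegral_itv intf) lim0).
Unshelve. all: by end_near. Qed.

(** The heat equation on the line. Differentiating the square root of the time
    produces a factor x, which integration by parts turns into a second
    derivative. *)
Lemma is_derive_gauss_mean_dilation phi phi1 phi2 M (t : R) : 0 < t ->
  (forall x : R, is_derive x 1 phi (phi1 x)) ->
  (forall x : R, is_derive x 1 phi1 (phi2 x)) -> continuous phi2 ->
  (forall x, `|phi x| <= M) -> (forall x, `|phi1 x| <= M) ->
  (forall x, `|phi2 x| <= M) ->
  is_derive t 1 (fun s => gauss_mean (fun x => phi (Num.sqrt s * x)))
    (4^-1 * gauss_mean (fun x => phi2 (Num.sqrt t * x))).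
Proof.
move=> t0 dphi dphi1 cphi2 phiM phi1M phi2M.
have cphi := is_derive_continuous dphi.
have cphi1 := is_derive_continuous dphi1.
have cdil (r : R) psi : continuous psi -> continuous (fun x => psi (r * x)).
  move=> cpsi x; apply: continuous_comp (cpsi _).
  by apply: cvgMr; exact: cvg_id.
have ddil (r x d : R) psi : is_derive (r * x) 1 psi d ->
    is_derive x 1 (fun y => psi (r * y)) (r * d).
  move=> dpsi; have h : is_derive x 1 ( *%R r) r.
    by apply: is_derive_eq; rewrite /GRing.scale /= mulr1.
  by rewrite mulrC; exact: (@is_derive1_comp _ psi ( *%R r)).
have ddil' (r x d : R) psi : is_derive (r * x) 1 psi d ->
    is_derive r 1 (fun y => psi (y * x)) (x * d).
  by rewrite mulrC => /ddil; congr is_derive; apply/funext => y; rewrite mulrC.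
pose f (r x : R) := phi (r * x) * gauss_density x.
pose G (x : R) := (M * (1 + x ^+ 2)) * gauss_density x.
have M0 : 0 <= M by exact: le_trans (phiM 0).
have intG : mu.-integrable setT (EFin \o G).
  apply/gauss_integrableZ/gauss_integrableD; first exact: gauss_integrable1.
  exact: gauss_integrable_sqr.
have intf (r : R) : mu.-integrable setT (EFin \o f r).
  by apply: (gauss_integrable_bounded (cdil r _ cphi)) => x; exact: phiM.
have df (r x : R) : is_derive r 1 (f ^~ x) (x * phi1 (r * x) * gauss_density x).
  have h := ddil' r x _ phi (dphi _).
  have -> : f ^~ x = (gauss_density x) \*: (fun r => phi (r * x)).
    by apply/funext => y; rewrite /f /= mulrC.
  by apply: is_derive_eq; rewrite /GRing.scale /= mulrC.
have dfG (r x : R) : `|x * phi1 (r * x) * gauss_density x| <= G x.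
  rewrite (normrM (x * _) (gauss_density _)) (ger0_norm (gauss_density_ge0 _)).
  rewrite ler_wpM2r ?gauss_density_ge0// normrM mulrC ler_pM//.
  rewrite -[x ^+ 2]real_normK ?num_real//; have := sqr_ge0 (`|x| - 1).
  rewrite sqrrB; have := normr_ge0 x; lra.
have dF (r : R) : is_derive r 1 (fun r => \int[mu]_x f r x)
    (gauss_mean (fun x => x * phi1 (r * x))).
  exact: is_derive_under_Rintegral intf df intG dfG.
have st0 : 0 < Num.sqrt t by rewrite sqrtr_gt0.
have -> : 4^-1 * gauss_mean (fun x => phi2 (Num.sqrt t * x)) =
    gauss_mean (fun x => x * phi1 (Num.sqrt t * x)) * (2 * Num.sqrt t)^-1.
  rewrite (@gauss_mean_id_mul _ (fun x => Num.sqrt t * phi2 (Num.sqrt t * x))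
    ((1 + Num.sqrt t) * M)).
  - rewrite gauss_meanZ; first by field; rewrite gt_eqF.
    by apply: (gauss_integrable_bounded (cdil _ _ cphi2)) => x; exact: phi2M.
  - by move=> x; apply: cvgMr; exact: cdil.
  - move=> x; apply: le_trans (phi1M _) _.
    by rewrite mulrDl mul1r lerDl mulr_ge0// ltW.
  - move=> x; rewrite normrM gtr0_norm// ler_pM// ?ltW//.
    by rewrite ltrDr.
have h := is_derive1_sqrt t0.
exact: (@is_derive1_comp _ (fun r => \int[mu]_x f r x) Num.sqrt t).
Qed.

End GaussianIntegrationByParts.

(** * The heat kernel on the line *)

Section HeatDensity.
Context {R : realType}.
Notation mu := (@lebesgue_measure R).
Implicit Types (phi psi : R -> R) (M : R).

Definition heat_density (t x : R) : R :=
  (Num.sqrt (t * pi))^-1 * expR (- (x ^+ 2 / t)).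

Lemma heat_density_ge0 t x : 0 <= heat_density t x.
Proof. by rewrite mulr_ge0 ?invr_ge0 ?sqrtr_ge0 ?expR_ge0. Qed.

Lemma continuous_heat_density t a : continuous (fun x => heat_density t (x - a)).
Proof.
move=> x; apply: cvgMr; apply: continuous_comp; last exact: continuous_expR.
apply: cvgN; apply: cvgMl; apply: (@continuous_comp _ _ _ (fun z => z - a) (fun z => z ^+ 2)).
  by apply: cvgB; [exact: cvg_id|exact: cvg_cst].
exact: exprn_continuous.
Qed.

Lemma heat_density_dilation t y : 0 < t ->
  heat_density t (Num.sqrt t * y) * Num.sqrt t = gauss_density y.
Proof.
move=> t0; rewrite /heat_density /gauss_density /gauss_fun exprMn sqr_sqrtr ?ltW//.
rewrite sqrtrM ?ltW// invfM.
have -> : t * y ^+ 2 / t = y ^+ 2 by field; rewrite gt_eqF.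
by field; rewrite !gt_eqF ?sqrtr_gt0 ?pi_gt0.
Qed.

Lemma ge0_integral_heat_density phi t a : 0 < t -> continuous phi ->
  (forall x, 0 <= phi x) ->
  (\int[mu]_x (phi x * heat_density t (x - a))%:E =
   \int[mu]_y (phi (a + Num.sqrt t * y) * gauss_density y)%:E)%E.
Proof.
move=> t0 cphi phi0.
have st0 : 0 < Num.sqrt t by rewrite sqrtr_gt0.
pose F (y : R) := a + Num.sqrt t * y.
have dF (y : R) : is_derive y 1 F (Num.sqrt t).
  rewrite /F; apply: is_derive_eq; rewrite /GRing.scale /=; ring.
have F'E : F^`()%classic = fun=> Num.sqrt t.
  by apply/funext => y; rewrite derive1E derive_val.
rewrite (@increasing_ge0_integration_by_substitutionT _ F).
- apply: eq_integral => y _; congr (_%:E); rewrite F'E !fctE /F.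
  by rewrite -mulrA [a + _ - a]addrC addKr heat_density_dilation.
- by move=> x y xy; rewrite /F ltrD2l ltr_pM2l.
- by rewrite F'E => y; exact: cvg_cst.
- by rewrite F'E; exact: is_cvg_cst.
- by rewrite F'E; exact: is_cvg_cst.
- by move=> y; have := dF y.
- apply/cvgrNyPle => A; near=> y; rewrite /F -lerBrDl mulrC -(ler_pdivlMr _ _ st0).
  by near: y; apply: nbhs_ninfty_le; exact: num_real.
- apply/cvgryPge => A; near=> y; rewrite /F -lerBlDl mulrC -(ler_pdivrMr _ _ st0).
  by near: y; apply: nbhs_pinfty_ge; exact: num_real.
- by move=> x; apply: cvgM; [exact: cphi|exact: continuous_heat_density].
- by move=> x; rewrite mulr_ge0 ?heat_density_ge0.
Unshelve. all: by end_near. Qed.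

Lemma heat_density_integrable phi M t a : 0 < t -> continuous phi ->
  (forall x, `|phi x| <= M) ->
  mu.-integrable setT (EFin \o (fun x => phi x * heat_density t (x - a))).
Proof.
move=> t0 cphi phiM.
have M0 : 0 <= M by exact: le_trans (phiM 0).
have h1 : mu.-integrable setT (EFin \o (fun x => M * heat_density t (x - a))).
  apply/integrableP; split.
    apply/measurable_EFinP; apply: measurable_funM => //.
    by apply: continuous_measurable_fun; exact: continuous_heat_density.
  under eq_integral => x _ do rewrite /= ger0_norm ?mulr_ge0 ?heat_density_ge0//.
  rewrite (@ge0_integral_heat_density (fun=> M))//; last by move=> x; exact: cvg_cst.
  have := gauss_integrable_cst M => /integrableP[_]; apply: le_lt_trans.
  rewrite le_eqVlt; apply/orP; left; apply/eqP/eq_integral => y _ /=.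
  by rewrite ger0_norm//; exact: mulr_ge0 (gauss_density_ge0 _).
apply: le_integrable h1 => //.
  apply/measurable_EFinP; apply: continuous_measurable_fun => x.
  by apply: cvgM; [exact: cphi|exact: continuous_heat_density].
move=> x _ /=; rewrite lee_fin !(normrM _ (heat_density _ _)) ler_wpM2r//.
by rewrite (le_trans (phiM x))// ler_norm.
Qed.

(** Adding a constant to the bounded function makes it nonnegative. *)
Lemma Rintegral_heat_density phi M t a : 0 < t -> continuous phi ->
  (forall x, `|phi x| <= M) ->
  \int[mu]_x (phi x * heat_density t (x - a)) =
  gauss_mean (fun y => phi (a + Num.sqrt t * y)).
Proof.
move=> t0 cphi phiM.
have M0 : 0 <= M by exact: le_trans (phiM 0).
have cM : continuous (fun _ : R => M) by move=> x; exact: cvg_cst.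
have key psi : continuous psi -> (forall x, 0 <= psi x) ->
  \int[mu]_x (psi x * heat_density t (x - a)) =
  gauss_mean (fun y => psi (a + Num.sqrt t * y)).
  by move=> cpsi psi0; rewrite /gauss_mean /Rintegral ge0_integral_heat_density.
have caff : continuous (fun y => phi (a + Num.sqrt t * y)).
  move=> y; apply: continuous_comp; last exact: cphi.
  by apply: cvgD; [exact: cvg_cst|apply: cvgMr; exact: cvg_id].
have cphiM : continuous (fun x => phi x + M).
  by move=> x; apply: cvgD; [exact: cphi|exact: cvg_cst].
have phiM0 x : 0 <= phi x + M.
  by have := phiM x; rewrite ler_norml => /andP[]; rewrite -subr_ge0 opprK.
have h1 := key _ cphiM phiM0.
have h2 := key _ cM (fun=> M0).
have iphi := heat_density_integrable a t0 cphi phiM.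
have iM : mu.-integrable setT (EFin \o (fun x => M * heat_density t (x - a))).
  by apply: (@heat_density_integrable (fun=> M) M) => // x; rewrite ger0_norm.
have e1 : \int[mu]_x ((phi x + M) * heat_density t (x - a)) =
    \int[mu]_x (phi x * heat_density t (x - a)) +
    \int[mu]_x (M * heat_density t (x - a)).
  rewrite -RintegralD//; by apply: eq_Rintegral => x _; rewrite mulrDl.
have igauss := gauss_integrable_bounded caff (fun y => phiM _).
move: h1; rewrite e1 h2 (gauss_meanD igauss (gauss_integrable_cst M)).
exact: addIr.
Qed.

End HeatDensity.

(** * Calculus along the coordinate directions *)

(** Locked, to keep the underlying matrix operations folded. *)
HB.lock Definition shift (R : realType) (n : nat) (z : 'rV[R[i]]_n)
    (d : 'I_n * bool) (s : R) : 'rV[R[i]]_n :=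
  z + (s%:C)%C *: real_dir R d.

Section DirectionalCalculus.
Context {R : realType} {n : nat}.
Local Notation Cn := 'rV[R[i]]_n.
Implicit Types (u v w : Cn -> R) (z : Cn) (d : 'I_n * bool) (s M : R).

Lemma shift0 z d : shift z d 0 = z.
Proof. by rewrite shift.unlock scale0r addr0. Qed.

Lemma shift_shift z d s r : shift (shift z d s) d r = shift z d (s + r).
Proof.
by rewrite shift.unlock -addrA -scalerDl -(rmorphD (real_complex R)).
Qed.

Lemma shift_rebase z d s r : shift z d r = shift (shift z d s) d (r - s).
Proof. by rewrite shift_shift; congr shift; ring. Qed.

Lemma shiftAC z d s d' r :
  shift (shift z d s) d' r = shift (shift z d' r) d s.
Proof. rewrite shift.unlock; exact: addrAC. Qed.

Lemma along_shift (h : Cn -> R[i]) d z s : along h d z s = h (shift z d s).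
Proof. by rewrite shift.unlock. Qed.

Definition partial d u z : R := derive1 (fun s => u (shift z d s)) 0.

Definition bounded_fun u := exists M, forall z, `|u z| <= M.

(** Uniform continuity under displacements along the coordinate directions:
    these are the displacements in the averages and difference quotients
    below. *)
Definition dir_unif_cont u := forall d e, 0 < e ->
  exists2 r : R, 0 < r & forall z s, `|s| < r -> `|u (shift z d s) - u z| < e.

(** In contrast to [C_buc], recursive in the order, with the innermost
    derivative taken first. *)
Fixpoint buc m u : Prop :=
  [/\ bounded_fun u, dir_unif_cont u &
    if m is m'.+1 then
      (forall d z, derivable (fun s => u (shift z d s)) 0 1) /\
      (forall d, buc m' (partial d u))
    else True].

Definition has_partial d u v :=
  forall z, is_derive (0 : R) 1 (fun s => u (shift z d s)) (v z).

Lemma has_partialE d u v : has_partial d u v -> partial d u = v.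
Proof.
by move=> duv; apply/funext => z; rewrite /partial derive1E; have h := duv z; rewrite derive_val.
Qed.

Lemma buc_has_partial m d u : buc m.+1 u -> has_partial d u (partial d u).
Proof.
move=> /= [_ _ [du _]] z.
apply: DeriveDef.
  exact: du.
rewrite /partial.
by rewrite derive1E.
Qed.

Lemma buc_partial m d u : buc m.+1 u -> buc m (partial d u).
Proof. by move=> /= [_ _ []]. Qed.

Lemma bucS m u : bounded_fun u -> dir_unif_cont u ->
  (forall d, exists2 v, has_partial d u v & buc m v) -> buc m.+1 u.
Proof.
move=> bu cu du; split=> //; split=> [d z|d].
  by have [v duv _] := du d; have := duv z.
by have [v duv bv] := du d; rewrite (has_partialE duv).
Qed.

Lemma buc_bounded m u : buc m u -> bounded_fun u.
Proof. by case: m => [|m] []. Qed.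

Lemma buc_unif_cont m u : buc m u -> dir_unif_cont u.
Proof. by case: m => [|m] []. Qed.

Lemma buc0 m u : buc m u -> buc 0 u.
Proof. by move=> bu; split; [exact: buc_bounded bu|exact: buc_unif_cont bu|]. Qed.

Lemma bucW m u : buc m.+1 u -> buc m u.
Proof.
elim: m u => [|m IHm] u bu; first exact: buc0 bu.
case: bu => bu cu [du pu]; split => //; split => // d; exact/IHm/pu.
Qed.

Lemma buc_le m m' u : (m <= m')%N -> buc m' u -> buc m u.
Proof.
move=> /subnK <-; elim: (m' - m)%N => // k IHk; rewrite addSn => /bucW; exact: IHk.
Qed.

Lemma has_partial_shift d u v z s : has_partial d u v ->
  is_derive s 1 (fun r => u (shift z d r)) (v (shift z d s)).
Proof.
move=> duv.
have -> : (fun r => u (shift z d r)) =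
    (fun r => u (shift (shift z d s) d r)) \o (fun r => r - s).
  by apply/funext => r /=; rewrite (shift_rebase z d s).
have h1 : is_derive s 1 (fun r : R => r - s) 1.
  by apply: is_derive_eq; rewrite subr0.
rewrite -[v _]mulr1; apply: is_derive1_comp; rewrite subrr; exact: duv.
Qed.

Lemma dir_unif_cont_continuous u z d :
  dir_unif_cont u -> continuous (fun s => u (shift z d s)).
Proof.
move=> cu s; apply/cvgrPdist_lt => e /(cu d)[r r0 ur].
apply/nbhs_ballP; exists r => //= y; rewrite /ball /= distrC => sy.
by rewrite distrC (shift_rebase z d s y); exact: ur.
Qed.

Lemma bounded_fun_pos u : bounded_fun u ->
  exists2 M, 0 < M & forall z, `|u z| <= M.
Proof.
move=> [M uM]; exists (`|M| + 1) => [|z]; first by rewrite ltr_wpDl.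
by rewrite (le_trans (uM z))// (le_trans (ler_norm _))// lerDl.
Qed.

Lemma bounded_funD u v :
  bounded_fun u -> bounded_fun v -> bounded_fun (fun z => u z + v z).
Proof.
move=> [M uM] [N vN]; exists (M + N) => z.
by rewrite (le_trans (ler_normD _ _))// lerD.
Qed.

Lemma bounded_funM u v :
  bounded_fun u -> bounded_fun v -> bounded_fun (fun z => u z * v z).
Proof. by move=> [M uM] [N vN]; exists (M * N) => z; rewrite normrM ler_pM. Qed.

Lemma dir_unif_contD u v : dir_unif_cont u -> dir_unif_cont v ->
  dir_unif_cont (fun z => u z + v z).
Proof.
move=> cu cv d e e0.
have e2 : 0 < e / 2 by rewrite divr_gt0.
have [r r0 ur] := cu d _ e2; have [r' r'0 vr] := cv d _ e2.
exists (Num.min r r') => [|z s]; first by rewrite lt_min r0.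
rewrite lt_min => /andP[/(ur z) ? /(vr z) ?].
rewrite opprD addrACA (le_lt_trans (ler_normD _ _))//; lra.
Qed.

Lemma dir_unif_contM u v : bounded_fun u -> bounded_fun v ->
  dir_unif_cont u -> dir_unif_cont v -> dir_unif_cont (fun z => u z * v z).
Proof.
move=> /bounded_fun_pos[M M0 uM] /bounded_fun_pos[N N0 vN] cu cv d e e0.
have e1 : 0 < e / 3 / N by rewrite !divr_gt0.
have e2 : 0 < e / 3 / M by rewrite !divr_gt0.
have [r r0 ur] := cu d _ e1; have [r' r'0 vr] := cv d _ e2.
exists (Num.min r r') => [|z s]; first by rewrite lt_min r0.
rewrite lt_min => /andP[/(ur z) h1 /(vr z) h2].
set z' := shift z d s in h1 h2 *.
have -> : u z' * v z' - u z * v z = (u z' - u z) * v z' + u z * (v z' - v z) by ring.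
rewrite (le_lt_trans (ler_normD _ _))// !normrM.
have b1 : `|u z' - u z| * `|v z'| <= e / 3 / N * N by rewrite ler_pM// ltW.
have b2 : `|u z| * `|v z' - v z| <= M * (e / 3 / M) by rewrite ler_pM// ltW.
rewrite divfK ?gt_eqF// in b1; rewrite [M * _]mulrC divfK ?gt_eqF// in b2; lra.
Qed.

Lemma bounded_fun_cst c : bounded_fun (fun=> c).
Proof. by exists `|c|. Qed.

Lemma dir_unif_cont_cst c : dir_unif_cont (fun=> c).
Proof. by move=> d e e0; exists 1 => // z s _; rewrite subrr normr0. Qed.

Lemma has_partialD d u u' v v' : has_partial d u u' -> has_partial d v v' ->
  has_partial d (fun z => u z + v z) (fun z => u' z + v' z).
Proof. by move=> hu hv z; have := hu z; have := hv z => ? ?; exact: is_deriveD. Qed.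

Lemma has_partialM d u u' v v' : has_partial d u u' -> has_partial d v v' ->
  has_partial d (fun z => u z * v z) (fun z => u' z * v z + u z * v' z).
Proof.
move=> hu hv z; have hu' := hu z; have hv' := hv z.
by apply: is_derive_eq; rewrite /GRing.scale /= shift0; ring.
Qed.

Lemma has_partial_cst d c : has_partial d (fun=> c) (fun=> 0).
Proof. by move=> z; exact: is_derive_cst. Qed.

Lemma buc_cst m c : buc m (fun=> c).
Proof.
elim: m c => [|m IHm] c.
  by split=> //; [exact: bounded_fun_cst|exact: dir_unif_cont_cst].
apply: bucS => [||d]; [exact: bounded_fun_cst|exact: dir_unif_cont_cst|].
by exists (fun=> 0); [exact: has_partial_cst|exact: IHm].
Qed.

Lemma bucD m u v : buc m u -> buc m v -> buc m (fun z => u z + v z).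
Proof.
elim: m u v => [|m IHm] u v bu bv.
  split=> //; first exact: bounded_funD (buc_bounded bu) (buc_bounded bv).
  exact: dir_unif_contD (buc_unif_cont bu) (buc_unif_cont bv).
apply: bucS => [||d].
- exact: bounded_funD (buc_bounded bu) (buc_bounded bv).
- exact: dir_unif_contD (buc_unif_cont bu) (buc_unif_cont bv).
- have pu := buc_has_partial d bu; have pv := buc_has_partial d bv.
  exists (fun z => partial d u z + partial d v z); first exact: has_partialD.
  by apply: IHm; exact: buc_partial.
Qed.

Lemma bucM m u v : buc m u -> buc m v -> buc m (fun z => u z * v z).
Proof.
have M0 k u' v' : buc k u' -> buc k v' ->
    bounded_fun (fun z => u' z * v' z) /\ dir_unif_cont (fun z => u' z * v' z).
  move=> bu bv; have := (buc_bounded bu, buc_bounded bv) => -[bu0 bv0].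
  split; first exact: bounded_funM.
  by apply: dir_unif_contM => //; [exact: buc_unif_cont bu|exact: buc_unif_cont bv].
elim: m u v => [|m IHm] u v bu bv; have [b c] := M0 _ _ _ bu bv; first by split.
apply: bucS => // d.
have pu := buc_has_partial d bu; have pv := buc_has_partial d bv.
exists (fun z => partial d u z * v z + u z * partial d v z); first exact: has_partialM.
by apply: bucD; apply: IHm => //; [exact: buc_partial|exact: bucW|exact: bucW|exact: buc_partial].
Qed.

Lemma bucZ m c u : buc m u -> buc m (fun z => c * u z).
Proof. by move=> bu; apply: bucM => //; exact: buc_cst. Qed.

Lemma partialD m d u v : buc m.+1 u -> buc m.+1 v ->
  partial d (fun z => u z + v z) = (fun z => partial d u z + partial d v z).
Proof.
move=> bu bv; apply: has_partialE.
exact: has_partialD (buc_has_partial d bu) (buc_has_partial d bv).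
Qed.

Lemma partialM m d u v : buc m.+1 u -> buc m.+1 v ->
  partial d (fun z => u z * v z) =
  (fun z => partial d u z * v z + u z * partial d v z).
Proof.
move=> bu bv; apply: has_partialE.
exact: has_partialM (buc_has_partial d bu) (buc_has_partial d bv).
Qed.

Lemma partialZ m d c u : buc m.+1 u ->
  partial d (fun z => c * u z) = (fun z => c * partial d u z).
Proof.
move=> bu; rewrite (partialM _ (buc_cst m.+1 c) bu) (has_partialE (has_partial_cst d c)).
by apply/funext => z; rewrite mul0r add0r.
Qed.

Lemma partial_mean_value m d u z s : buc m.+1 u -> 0 < s ->
  exists2 c, 0 < c < s &
    u (shift z d s) - u z = s * partial d u (shift z d c).
Proof.
move=> bu s0; have du := buc_has_partial d bu.
have [||c] := @MVT R (fun r => u (shift z d r)) (fun r => partial d u (shift z d r)) 0 s s0.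
- by move=> r _; exact: has_partial_shift.
- by apply: continuous_subspaceT; apply: dir_unif_cont_continuous; exact: buc_unif_cont bu.
by rewrite in_itv /= shift0 subr0 mulrC => cs e; exists c.
Qed.

Lemma has_partial_translate d d' u v s : has_partial d u v ->
  has_partial d (fun z => u (shift z d' s)) (fun z => v (shift z d' s)).
Proof.
move=> duv z; have := duv (shift z d' s).
have -> : (fun r => u (shift (shift z d r) d' s)) =
    (fun r => u (shift (shift z d' s) d r)).
  by apply/funext => r; rewrite shiftAC.
by [].
Qed.

Lemma buc_translate m d s u : buc m u -> buc m (fun z => u (shift z d s)).
Proof.
have bt u' : bounded_fun u' -> bounded_fun (fun z => u' (shift z d s)).
  by move=> [M uM]; exists M => z.
have ct u' : dir_unif_cont u' -> dir_unif_cont (fun z => u' (shift z d s)).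
  move=> cu d' e /(cu d')[r r0 ur]; exists r => // z s' /ur; rewrite shiftAC; exact.
elim: m u => [|m IHm] u bu.
  by split=> //; [exact/bt/(buc_bounded bu)|exact/ct/(buc_unif_cont bu)].
apply: bucS => [||d']; [exact/bt/(buc_bounded bu)|exact/ct/(buc_unif_cont bu)|].
exists (fun z => partial d' u (shift z d s)); last exact/IHm/buc_partial.
exact/has_partial_translate/(buc_has_partial _ bu).
Qed.

(** The mean value theorem is applied twice, the first time to the increment
    of [u] in the direction [d']. *)
Lemma second_difference m d d' u z s : buc m.+2 u -> 0 < s ->
  exists c c', [/\ 0 < c < s, 0 < c' < s &
    (u (shift (shift z d s) d' s) - u (shift z d s)) -
      (u (shift z d' s) - u z) =
    s ^+ 2 * partial d' (partial d u) (shift (shift z d c) d' c')].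
Proof.
move=> bu s0.
pose v z := u (shift z d' s) + (-1) * u z.
have bu1 : buc m.+2 (fun z => u (shift z d' s)) by exact: buc_translate.
have bv : buc m.+2 v by apply: bucD; [|exact: bucZ].
have [c cs e1] := partial_mean_value d z bv s0.
have [c' cs' e2] := partial_mean_value d' (shift z d c) (buc_partial d bu) s0.
exists c, c'; split => //.
rewrite expr2 -mulrA -e2.
have -> : partial d u (shift (shift z d c) d' s) - partial d u (shift z d c) =
    partial d v (shift z d c).
  rewrite (partialD _ bu1 (bucZ (-1) bu)) (partialZ _ _ bu).
  by rewrite (has_partialE (has_partial_translate d' s (buc_has_partial d bu))) mulN1r.
by rewrite -e1 /v !mulN1r.
Qed.

Lemma second_differenceC (a b c e : R) : a - b - (c - e) = a - c - (b - e).
Proof. by ring. Qed.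

Lemma dist_le_chain4 (x y p q r e : R) : `|p - x| < e / 4 ->
  `|q - p| < e / 4 -> `|q - r| < e / 4 -> `|r - y| < e / 4 -> `|x - y| <= e.
Proof. by rewrite !ltr_norml ler_norml; lra. Qed.

(** Both iterated partial derivatives are limits of the same second difference
    quotient. *)
Lemma partialC m d d' u : buc m.+2 u ->
  partial d' (partial d u) = partial d (partial d' u).
Proof.
move=> bu; apply/funext => z.
have c1 := buc_unif_cont (buc_partial d' (buc_partial d bu)).
have c2 := buc_unif_cont (buc_partial d (buc_partial d' bu)).
apply/eqP; rewrite -subr_eq0 -normr_le0; apply/ler_addgt0Pl => e e0; rewrite addr0.
(* Two shifts lead from z to each of the two points provided by the second
   differences, so four errors add up. *)
have e4 : 0 < e / 4 by rewrite divr_gt0.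
have [r1 r10 h1] := c1 d _ e4; have [r2 r20 h2] := c1 d' _ e4.
have [r3 r30 h3] := c2 d _ e4; have [r4 r40 h4] := c2 d' _ e4.
pose s := Num.min (Num.min r1 r2) (Num.min r3 r4).
have s0 : 0 < s by rewrite !lt_min r10 r20 r30 r40.
have [c [c' [cs cs' E1]]] := second_difference d d' z bu s0.
have [b [b' [bs bs' E2]]] := second_difference d' d z bu s0.
have E : partial d' (partial d u) (shift (shift z d c) d' c') =
    partial d (partial d' u) (shift (shift z d' b) d b').
  have s2 : s ^+ 2 != 0 by rewrite expf_neq0 ?gt_eqF.
  apply: (mulfI s2); apply: etrans (etrans (esym E1) _) E2.
  rewrite (shiftAC z d s d' s); exact: second_differenceC.
have lts x : 0 < x < s -> [/\ `|x| < r1, `|x| < r2, `|x| < r3 & `|x| < r4].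
  move=> /andP[x0 xs]; rewrite (gtr0_norm x0).
  by split; apply: lt_le_trans xs _; rewrite /s !ge_min lexx ?orbT.
have [k1 _ _ _] := lts _ cs; have [_ k2 _ _] := lts _ cs'.
have [_ _ _ k4] := lts _ bs; have [_ _ k3 _] := lts _ bs'.
have {}h1 := h1 z _ k1; have {}h2 := h2 (shift z d c) _ k2.
have {}h4 := h4 z _ k4; have {}h3 := h3 (shift z d' b) _ k3.
rewrite E in h2; exact: (dist_le_chain4 h1 h2 h3 h4).
Qed.

End DirectionalCalculus.

(** * The heat flow in one direction *)

Section LineHeat.
Context {R : realType} {n : nat}.
Local Notation Cn := 'rV[R[i]]_n.
Local Notation mu := (@lebesgue_measure R).
Implicit Types (u v w : Cn -> R) (z : Cn) (d : 'I_n * bool) (s t M e : R).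

Lemma difference_quotientE (F : R -> R) (t l h : R) : h != 0 ->
  `|F (t + h) - F t - h * l| = `|l - h^-1 *: (F (h *: 1 + t) - F t)| * `|h|.
Proof.
move=> h0; have -> : h *: 1 + t = t + h by rewrite /GRing.scale /= mulr1 addrC.
rewrite -normrM distrC /GRing.scale /=; congr `|_|.
by rewrite mulrBl mulrAC mulVf// mul1r [l * h]mulrC.
Qed.

Lemma is_derive1P (F : R -> R) (t l : R) :
  (forall e, 0 < e -> exists2 r : R, 0 < r & forall h, `|h| < r ->
     `|F (t + h) - F t - h * l| <= e * `|h|) <-> is_derive t 1 F l.
Proof.
split=> [H|dF].
  have L : h^-1 *: (F (h *: 1 + t) - F t) @[h --> 0^'] --> l.
    apply/cvgrPdist_le => e e0; have [r r0 Fr] := H e e0.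
    exists r => //= h; rewrite /ball /= sub0r normrN => hr h0.
    have h0' : 0 < `|h| by rewrite normr_gt0.
    by rewrite -(ler_pM2r h0') -difference_quotientE//; exact: Fr.
  apply: DeriveDef; last exact: cvg_lim L.
  by apply/cvg_ex; exists l.
move=> e e0; have [/cvg_ex[l' L] dl] := dF.
have ll' : l' = l by rewrite -dl; apply/esym/cvg_lim.
rewrite {}ll' in L; move/cvgrPdist_le : L => /(_ e e0)[r /= r0 Fr].
exists r => // h hr; have [->|h0] := eqVneq h 0.
  by rewrite addr0 subrr mul0r subr0 normr0 mulr0.
have := Fr h; rewrite /ball /= sub0r normrN => /(_ hr h0).
have h0' : 0 < `|h| by rewrite normr_gt0.
by rewrite -(ler_pM2r h0') -difference_quotientE.
Qed.

(** The heat flow in the single direction [d], as a Gaussian average of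
    translates; this form shows at once that bounds, moduli of continuity and
    derivatives of [u] pass to it. *)
Definition line_heat t d u z : R :=
  gauss_mean (fun x => u (shift z d (Num.sqrt t * x))).

Lemma continuous_scaled_shift u z d (r : R) : dir_unif_cont u ->
  continuous (fun x => u (shift z d (r * x))).
Proof.
move=> cu x; apply: (@continuous_comp _ _ _ ( *%R r) (fun s => u (shift z d s))).
  by apply: cvgMr; exact: cvg_id.
exact: dir_unif_cont_continuous.
Qed.

Lemma line_heat_integrable m t d u z : buc m u ->
  gauss_integrable (fun x => u (shift z d (Num.sqrt t * x))).
Proof.
move=> bu; have [M uM] := buc_bounded bu.
apply: (@gauss_integrable_bounded _ _ M) => //.
exact: continuous_scaled_shift (buc_unif_cont bu).
Qed.

Lemma line_heat_bound m t d u M : buc m u -> (forall z, `|u z| <= M) ->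
  forall z, `|line_heat t d u z| <= M.
Proof.
move=> bu uM z; rewrite -(gauss_mean_cst M).
apply: norm_gauss_mean_le => //; last exact: gauss_integrable_cst.
exact: line_heat_integrable bu.
Qed.

Lemma line_heatD m t d u v : buc m u -> buc m v ->
  line_heat t d (fun z => u z + v z) =
  (fun z => line_heat t d u z + line_heat t d v z).
Proof.
by move=> bu bv; apply/funext => z; apply: gauss_meanD; apply: line_heat_integrable; eassumption.
Qed.

Lemma line_heatZ m t d c u : buc m u ->
  line_heat t d (fun z => c * u z) = (fun z => c * line_heat t d u z).
Proof.
by move=> bu; apply/funext => z; apply: gauss_meanZ; apply: line_heat_integrable; eassumption.
Qed.

Lemma line_heat_shift t d u z d' s :
  line_heat t d u (shift z d' s) = line_heat t d (fun z => u (shift z d' s)) z.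
Proof.
by apply: eq_Rintegral => x _; rewrite shiftAC.
Qed.

Lemma line_heatB m t d u v z : buc m u -> buc m v ->
  line_heat t d u z - line_heat t d v z =
  line_heat t d (fun z => u z + (-1) * v z) z.
Proof.
move=> bu bv; rewrite (line_heatD _ _ bu (bucZ (-1) bv)).
by rewrite (line_heatZ _ _ _ bv) mulN1r.
Qed.

Lemma line_heat_has_partial t d d' u : buc 1 u ->
  has_partial d' (line_heat t d u) (line_heat t d (partial d' u)).
Proof.
move=> bu z; have [M uM] := buc_bounded (buc_partial d' bu).
have hp := buc_has_partial d' bu.
pose y x := shift z d (Num.sqrt t * x).
have := @is_derive_under_Rintegral R
  (fun s x => u (shift (y x) d' s) * gauss_density x)
  (fun s x => partial d' u (shift (y x) d' s) * gauss_density x)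
  (fun x => M * gauss_density x) 0.
have -> : (fun s => line_heat t d u (shift z d' s)) =
    (fun s => \int[mu]_x (u (shift (y x) d' s) * gauss_density x)).
  by apply/funext => s; rewrite line_heat_shift.
have -> : line_heat t d (partial d' u) z =
    \int[mu]_x (partial d' u (shift (y x) d' 0) * gauss_density x).
  by apply: eq_Rintegral => x _; rewrite shift0.
apply.
- move=> s; have := line_heat_integrable t d z (buc_translate d' s bu).
  exact.
- move=> s x.
  have h := has_partial_shift (y x) s hp.
  have -> : (fun s => u (shift (y x) d' s) * gauss_density x) =
      gauss_density x \*: (fun s => u (shift (y x) d' s)).
    by apply/funext => r; rewrite mulrC.
  by apply: is_derive_eq; rewrite /GRing.scale /= mulrC.
- exact: gauss_integrable_cst.
- move=> s x; rewrite normrM (ger0_norm (gauss_density_ge0 x)).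
  by rewrite ler_wpM2r// gauss_density_ge0.
Qed.

Lemma line_heat_unif_cont t d u : buc 0 u -> dir_unif_cont (line_heat t d u).
Proof.
move=> bu d' e e0; have [r r0 ur] := buc_unif_cont bu d' (divr_gt0 e0 (ltr0Sn R 1)).
exists r => // z s sr; rewrite line_heat_shift.
rewrite (line_heatB _ _ _ (buc_translate d' s bu) bu).
have b := bucD (buc_translate d' s bu) (bucZ (-1) bu).
apply: (le_lt_trans (line_heat_bound (M := e / 2) _ _ b _ _)); last by lra.
by move=> z'; rewrite mulN1r ltW// ur.
Qed.

Lemma line_heat_buc m t d u : buc m u -> buc m (line_heat t d u).
Proof.
elim: m u => [|m IHm] u bu.
  split=> //; last exact: line_heat_unif_cont.
  by have [M uM] := buc_bounded bu; exists M; exact: line_heat_bound bu uM.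
apply: bucS => [||d'].
- by have [M uM] := buc_bounded bu; exists M; exact: line_heat_bound bu uM.
- exact/line_heat_unif_cont/(buc0 bu).
- exists (line_heat t d (partial d' u)); last exact/IHm/buc_partial.
  by apply: line_heat_has_partial; exact: buc_le bu.
Qed.

Lemma sqrt_dist_sqr s t : 0 <= s -> 0 <= t ->
  (Num.sqrt s - Num.sqrt t) ^+ 2 <= `|s - t|.
Proof.
move=> s0 t0; rewrite -real_normK ?num_real// expr2.
rewrite -[in leRHS](sqr_sqrtr s0) -[in leRHS](sqr_sqrtr t0) subr_sqr normrM.
rewrite ler_wpM2l// (le_trans (ler_normB _ _))//.
by rewrite !ger0_norm ?addr_ge0 ?sqrtr_ge0.
Qed.

(** Where the displacement exceeds the modulus of continuity, the oscillation
    is bounded by a multiple of its square, which has a finite mean. *)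
Lemma line_heat_time_cont d u e : buc 0 u -> 0 < e ->
  exists2 r : R, 0 < r & forall s t, 0 <= s -> 0 <= t -> `|s - t| < r ->
    forall z, `|line_heat s d u z - line_heat t d u z| <= e.
Proof.
move=> bu e0; have [M M0 uM] := bounded_fun_pos (buc_bounded bu).
have [r r0 ur] := buc_unif_cont bu d (divr_gt0 e0 (ltr0Sn R 1)).
pose K : R := gauss_mean (fun x => x ^+ 2).
have K0 : 0 <= K.
  rewrite -(gauss_mean_cst 0); apply: le_gauss_mean => [||x]; last exact: sqr_ge0.
    exact: gauss_integrable_cst.
  exact: gauss_integrable_sqr.
(* With this constant, 2 M is at most B times the square of any displacement
   that exceeds r. *)
pose B := 2 * M / r ^+ 2.
have B0 : 0 < B by rewrite /B divr_gt0 ?mulr_gt0 ?exprn_gt0.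
have BK0 : 0 < B * (K + 1) by rewrite mulr_gt0// ltr_wpDl.
exists (e / 2 / (B * (K + 1))) => [|s t s0 t0 st z]; first by rewrite !divr_gt0.
have is' := line_heat_integrable s d z bu; have it := line_heat_integrable t d z bu.
pose c := B * (Num.sqrt s - Num.sqrt t) ^+ 2.
have iB : gauss_integrable (fun x : R => e / 2 + c * x ^+ 2).
  apply: gauss_integrableD; first exact: gauss_integrable_cst.
  exact/gauss_integrableZ/gauss_integrable_sqr.
have E : line_heat s d u z - line_heat t d u z =
   gauss_mean (fun x => u (shift z d (Num.sqrt s * x)) +
     (-1) * u (shift z d (Num.sqrt t * x))).
  by rewrite gauss_meanD ?gauss_meanZ ?mulN1r//; exact: gauss_integrableZ.
rewrite E; apply: (le_trans (norm_gauss_mean_le _ iB _)).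
- by apply: gauss_integrableD => //; exact: gauss_integrableZ.
- move=> x; rewrite mulN1r.
  rewrite (shift_rebase z d (Num.sqrt t * x) (Num.sqrt s * x)) -mulrBl.
  have [h|h] := ltP `|(Num.sqrt s - Num.sqrt t) * x| r.
    rewrite (le_trans (ltW (ur _ _ h)))// lerDl mulr_ge0 ?sqr_ge0//.
    by rewrite mulr_ge0 ?sqr_ge0// ltW.
  rewrite (le_trans (ler_normB _ _))// (le_trans (lerD (uM _) (uM _)))//.
  apply: le_trans (_ : c * x ^+ 2 <= _); last by rewrite lerDr ltW ?divr_gt0.
  rewrite /c -mulrA -exprMn /B mulrAC ler_pdivlMr ?exprn_gt0//.
  rewrite -[(_ * x) ^+ 2]real_normK ?num_real//.
  rewrite (_ : M + M = 2 * M); last by ring.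
  by rewrite ler_pM2l ?mulr_gt0// lerXn2r// nnegrE ltW.
rewrite gauss_meanD; [|exact: gauss_integrable_cst|exact/gauss_integrableZ/gauss_integrable_sqr].
rewrite gauss_mean_cst gauss_meanZ; last exact: gauss_integrable_sqr.
rewrite -/K [leRHS]splitr lerD2l /c.
have h := sqrt_dist_sqr s0 t0; have h' := le_lt_trans h st.
rewrite ltr_pdivlMr// in h'; apply: le_trans (ltW h').
rewrite -mulrA mulrCA; apply: (ler_wpM2l (sqr_ge0 _)).
by apply: (ler_wpM2l (ltW B0)); rewrite lerDl.
Qed.

Lemma line_heat_is_derive t d u z : 0 < t -> buc 2 u ->
  is_derive t 1 (fun s => line_heat s d u z)
    (4^-1 * line_heat t d (partial d (partial d u)) z).
Proof.
move=> t0 bu.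
have b1 := buc_partial d bu; have b2 := buc_partial d b1.
have [M0 h0] := buc_bounded bu; have [M1 h1] := buc_bounded b1.
have [M2 h2] := buc_bounded b2.
pose M := Num.max M0 (Num.max M1 M2).
have e0 (x : R) : is_derive x 1 (fun s => u (shift z d s)) (partial d u (shift z d x)).
  exact/has_partial_shift/(buc_has_partial d bu).
have e1 (x : R) : is_derive x 1 (fun s => partial d u (shift z d s))
    (partial d (partial d u) (shift z d x)).
  exact/has_partial_shift/(buc_has_partial d b1).
have k0 x : `|u (shift z d x)| <= M by rewrite /M le_max h0.
have k1 x : `|partial d u (shift z d x)| <= M by rewrite /M !le_max h1 orbT.
have k2 x : `|partial d (partial d u) (shift z d x)| <= M.
  by rewrite /M !le_max h2 !orbT.
exact: is_derive_gauss_mean_dilation t0 e0 e1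
  (dir_unif_cont_continuous (buc_unif_cont b2)) k0 k1 k2.
Qed.

End LineHeat.

(** * The heat flow along several directions *)

Section HeatAlong.
Context {R : realType} {n : nat}.
Local Notation Cn := 'rV[R[i]]_n.
Implicit Types (u v w : Cn -> R) (z : Cn) (d : 'I_n * bool) (s t M e : R).
Implicit Types ds : seq ('I_n * bool).

Definition heat_along ds t u : Cn -> R := foldr (line_heat t) u ds.

Fixpoint quarter_laplacian ds u z : R :=
  if ds is d :: ds' then
    4^-1 * partial d (partial d u) z + quarter_laplacian ds' u z
  else 0.

Lemma quarter_laplacian_buc m ds u : buc m.+2 u -> buc m (quarter_laplacian ds u).
Proof.
move=> bu; elim: ds => [|d ds IH] /=; first exact: buc_cst.
by apply: bucD => //; apply: bucZ; apply: buc_partial; exact: buc_partial.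
Qed.

Lemma heat_along_buc m ds t u : buc m u -> buc m (heat_along ds t u).
Proof. by move=> bu; elim: ds => //= d ds; exact: line_heat_buc. Qed.

Lemma heat_along_bound m ds t u M : buc m u -> (forall z, `|u z| <= M) ->
  forall z, `|heat_along ds t u z| <= M.
Proof.
move=> bu uM; elim: ds => //= d ds IH.
exact: line_heat_bound (heat_along_buc ds t bu) IH.
Qed.

Lemma heat_alongD m ds t u v : buc m u -> buc m v ->
  heat_along ds t (fun z => u z + v z) =
  (fun z => heat_along ds t u z + heat_along ds t v z).
Proof.
move=> bu bv; elim: ds => //= d ds ->.
exact: line_heatD (heat_along_buc ds t bu) (heat_along_buc ds t bv).
Qed.

Lemma heat_alongZ m ds t c u : buc m u ->
  heat_along ds t (fun z => c * u z) = (fun z => c * heat_along ds t u z).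
Proof.
move=> bu; elim: ds => //= d ds ->; exact: line_heatZ (heat_along_buc ds t bu).
Qed.

Lemma heat_along_partial m ds t d u : buc m.+1 u ->
  partial d (heat_along ds t u) = heat_along ds t (partial d u).
Proof.
move=> bu; elim: ds => //= d' ds <-; apply: has_partialE.
by apply: line_heat_has_partial; apply: (@buc_le _ _ 1 m.+1) => //; exact: heat_along_buc.
Qed.

Lemma normD_le_half (a b e : R) :
  `|a| <= e / 2 -> `|b| <= e / 2 -> `|a + b| <= e.
Proof. by move=> ha hb; rewrite (le_trans (ler_normD _ _))//; lra. Qed.

Lemma heat_along_time_cont ds u t e : buc 0 u -> 0 <= t -> 0 < e ->
  exists2 r : R, 0 < r & forall s, 0 <= s -> `|s - t| < r ->
    forall z, `|heat_along ds s u z - heat_along ds t u z| <= e.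
Proof.
move=> bu t0; elim: ds e => [|d ds IH] e e0.
  by exists 1 => // s _ _ z /=; rewrite subrr normr0 ltW.
have e2 : 0 < e / 2 by rewrite divr_gt0.
have [r1 r10 h1] := IH _ e2.
have bt := heat_along_buc ds t bu.
have [r2 r20 h2] := line_heat_time_cont d bt e2.
exists (Num.min r1 r2) => [|s s0]; first by rewrite lt_min r10.
rewrite lt_min => /andP[sr1 sr2] z /=.
have bs := heat_along_buc ds s bu.
have -> : line_heat s d (heat_along ds s u) z - line_heat t d (heat_along ds t u) z
  = (line_heat s d (heat_along ds s u) z - line_heat s d (heat_along ds t u) z) +
    (line_heat s d (heat_along ds t u) z - line_heat t d (heat_along ds t u) z).
  by rewrite addrA subrK.
apply: normD_le_half; last exact: h2.
rewrite (line_heatB _ _ _ bs bt).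
apply: line_heat_bound (bucD bs (bucZ (-1) bt)) _ _ => z'.
by rewrite mulN1r; exact: h1.
Qed.

(** The mean value theorem for the difference of [F] and its tangent at [t]. *)
Lemma first_order_error_le (F F' : R -> R) t e (r h : R) :
  (forall s, `|s - t| < r -> is_derive s 1 F (F' s)) ->
  (forall s, `|s - t| < r -> `|F' s - F' t| <= e) -> `|h| < r ->
  `|F (t + h) - F t - h * F' t| <= e * `|h|.
Proof.
move=> dF F'e hr.
have dG s : `|s - t| < r ->
    is_derive s 1 (fun s => F s - s * F' t) (F' s - F' t).
  move=> /dF dFs; apply: is_derive_eq; rewrite /GRing.scale /=; ring.
have cG a b : (forall s, s \in `[a, b] -> `|s - t| < r) ->
    {within `[a, b], continuous (fun s => F s - s * F' t)}.
  move=> ab; apply: derivable_within_continuous => s /ab/dG ds; exact: ex_derive.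
have E : F (t + h) - F t - h * F' t =
   (F (t + h) - (t + h) * F' t) - (F t - t * F' t) by ring.
have [h0|h0|h0] := ltgtP h 0; last by rewrite h0 addr0 subrr mul0r subr0 normr0 mulr0.
- have rg s : s \in `[t + h, t] -> `|s - t| < r.
    rewrite in_itv /= => /andP[s1 s2]; rewrite ler0_norm ?subr_le0//.
    by move: hr; rewrite ltr0_norm//; lra.
  have [|||c] := @MVT R (fun s => F s - s * F' t) (fun s => F' s - F' t) (t + h) t.
  + by rewrite gtrDl.
  + by move=> s /subset_itv_oo_cc/rg/dG.
  + exact: cG.
  move=> /subset_itv_oo_cc/rg/F'e ce /eqP.
  rewrite E -eqr_opp opprB => /eqP ->; rewrite normrN normrM.
  by rewrite opprD addrA subrr add0r normrN ler_wpM2r.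
- have rg s : s \in `[t, t + h] -> `|s - t| < r.
    rewrite in_itv /= => /andP[s1 s2]; rewrite ger0_norm ?subr_ge0//.
    by move: hr; rewrite gtr0_norm//; lra.
  have [|||c] := @MVT R (fun s => F s - s * F' t) (fun s => F' s - F' t) t (t + h).
  + by rewrite ltrDl.
  + by move=> s /subset_itv_oo_cc/rg/dG.
  + exact: cG.
  move=> /subset_itv_oo_cc/rg/F'e ce.
  rewrite E => ->; rewrite normrM.
  by rewrite [t + h]addrC addrK ler_wpM2r.
Qed.

(** A product rule in time: the inner flow is differentiated uniformly in
    space, which its uniform continuity in time allows, so that its increment
    survives the outer average; the outer flow is differentiated with the inner
    function frozen at time [t]. *)
Lemma is_derive_heat_along ds t u z : 0 < t -> buc 2 u ->
  is_derive t 1 (fun s => heat_along ds s u z)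
    (heat_along ds t (quarter_laplacian ds u) z).
Proof.
move=> t0 bu; elim: ds z t t0 => [|d ds IH] z t t0 /=.
  exact: is_derive_cst.
have bA : buc 0 (quarter_laplacian ds u) by exact: quarter_laplacian_buc.
have bd : buc 0 (partial d (partial d u)) by do 2!apply: buc_partial.
have bv := heat_along_buc ds t bu.
have bw := heat_along_buc ds t bA.
set v := heat_along ds t u in bv; set w := heat_along ds t (quarter_laplacian ds u) in bw.
have -> : line_heat t d (heat_along ds t (fun z =>
      4^-1 * partial d (partial d u) z + quarter_laplacian ds u z)) z =
    4^-1 * line_heat t d (partial d (partial d v)) z + line_heat t d w z.
  rewrite (heat_alongD _ _ (bucZ 4^-1 bd) bA) (heat_alongZ _ _ _ bd).
  rewrite (line_heatD _ _ (bucZ 4^-1 (heat_along_buc ds t bd)) bw).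
  rewrite (line_heatZ _ _ _ (heat_along_buc ds t bd)).
  by rewrite -(heat_along_partial _ _ _ (buc_partial d bu)) -(heat_along_partial _ _ _ bu).
apply/is_derive1P => e e0.
have e3 : 0 < e / 3 by rewrite divr_gt0.
have [r1 r10 h1] := heat_along_time_cont ds bA (ltW t0) e3.
have /is_derive1P/(_ _ e3)[r2 r20 h2] := line_heat_is_derive d z t0 bv.
have [r3 r30 h3] := line_heat_time_cont d bw e3.
exists (Num.min (Num.min r1 t) (Num.min r2 r3)) => [|h].
  by rewrite !lt_min r10 t0 r20.
rewrite !lt_min => /andP[/andP[hr1 ht] /andP[hr2 hr3]].
have th0 : 0 <= t + h by move: ht; rewrite ltr_norml => /andP[? _]; lra.
have hth : `|t + h - t| = `|h| by rewrite addrAC subrr add0r.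
have bvh := heat_along_buc ds (t + h) bu.
set vh := heat_along ds (t + h) u in bvh *.
have k1 z' : `|vh z' - v z' - h * w z'| <= e / 3 * `|h|.
  apply: (@first_order_error_le (fun s => heat_along ds s u z')
    (fun s => heat_along ds s (quarter_laplacian ds u) z') t _ (Num.min r1 t)).
  - move=> s; rewrite lt_min => /andP[_ st]; apply: IH.
    by move: st; rewrite ltr_norml => /andP[? _]; lra.
  - move=> s; rewrite lt_min => /andP[sr st]; apply: h1 => //.
    by move: st; rewrite ltr_norml => /andP[? _]; lra.
  - by rewrite lt_min hr1.
have k2 := h2 _ hr2.
have k3 : `|line_heat (t + h) d w z - line_heat t d w z| <= e / 3.
  by apply: h3; rewrite ?hth ?(ltW t0).
have b1 := bucD (bucW (bucW bvh)) (bucZ (-1) (bucW (bucW bv))).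
have b2 := bucD b1 (bucZ (- h) bw).
have k1' : `|line_heat (t + h) d (fun z => vh z + -1 * v z + - h * w z) z| <= e / 3 * `|h|.
  apply: line_heat_bound b2 _ _ => z'; rewrite mulN1r mulNr; exact: k1.
rewrite (line_heatD _ _ b1 (bucZ (- h) bw)) (line_heatD _ _ bvh (bucZ (-1) bv)) in k1'.
rewrite (line_heatZ _ _ _ bv) (line_heatZ _ _ _ bw) in k1'.
rewrite -/v -/vh; set a1 := line_heat (t + h) d vh z in k1' *.
set a2 := line_heat (t + h) d v z in k1' k2.
set a3 := line_heat (t + h) d w z in k1' k3.
set c1 := line_heat t d v z in k2 *; set c3 := line_heat t d w z in k3 *.
set c2 := line_heat t d _ z in k2 *.
(* The error splits into that of the inner flow, that of the outer flow, and
   the change in time of the outer average of the inner derivative. *)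
have -> : a1 - c1 - h * (4^-1 * c2 + c3) =
  (a1 + -1 * a2 + - h * a3) + (a2 - c1 - h * (4^-1 * c2)) + h * (a3 - c3) by ring.
have k3' : `|h * (a3 - c3)| <= e / 3 * `|h| by rewrite normrM mulrC ler_wpM2r.
rewrite (le_trans (ler_normD _ _))// (le_trans (lerD (ler_normD _ _) (lexx _)))//.
rewrite (_ : e * `|h| = e / 3 * `|h| + e / 3 * `|h| + e / 3 * `|h|); last by field.
by rewrite lerD// lerD.
Qed.

End HeatAlong.

(** * Fubini for the Gaussian weight *)

Section PowerMeasureHeat.
Context {R : realType}.
Local Notation mu := (@lebesgue_measure R).
Local Notation RT := (measurableTypeR R).

Import HBSimple.

(** A function of two variables that is continuous in the first and measurable
    in the second is a pointwise limit of functions that depend on the first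
    variable only through a simple function. *)
Lemma caratheodory_measurable d (T : measurableType d) (F : R -> T -> R) :
  (forall x, measurable_fun setT (F x)) -> (forall s, continuous (F ^~ s)) ->
  measurable_fun setT (fun p : RT * T => F p.1 p.2).
Proof.
move=> mF cF.
have mid : measurable_fun [set: RT] (EFin : RT -> \bar R).
  by apply/measurable_EFinP.
have [g gcvg] := approximation_sfun measurableT mid.
apply: (@measurable_fun_cvg _ (RT * T)%type R setT
  (fun n (p : RT * T) => F (g n p.1) p.2) (fun p => F p.1 p.2)); last first.
  move=> [x s] _ /=; have gx : (g n x : R) @[n --> \oo] --> (x : R).
    by have /fine_cvg := gcvg x I.
  exact: (cvg_comp _ _ gx (cF s x)).
move=> n _ Y mY; rewrite setTI.
rewrite (_ : _ @^-1` _ = \bigcup_(r in range (g n))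
    ((g n @^-1` [set r]) `*` (F r @^-1` Y))); last first.
  apply/seteqP; split => [[x s] /= FY|[x s] [r _ [/= -> //]]].
  by exists (g n x); [exists x|split].
apply: fin_bigcup_measurable => [|r _]; first exact: fimfunP.
apply: measurableX; first exact: measurable_sfunP.
by rewrite -[X in measurable X]setTI; exact: mF.
Qed.

Lemma measurable_tuple_cons m (f : m.+1.-tuple RT -> R) :
  measurable_fun setT (fun p : RT * m.-tuple RT => f (pair_cons p)) ->
  measurable_fun setT f.
Proof.
move=> mf.
pose h (x : m.+1.-tuple RT) := (thead x, [tuple of behead x]).
have mh : measurable_fun setT h.
  by apply/measurable_fun_pair; [exact: (measurable_tnth ord0)|exact: measurable_behead].
rewrite (_ : f = (fun p => f (pair_cons p)) \o h); first exact: measurableT_comp.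
by apply/funext => x /=; congr f; rewrite [LHS]tuple_eta; apply/val_inj.
Qed.

Fixpoint tuple_density (t : R) (c w : seq R) : R :=
  if c is a :: c' then
    if w is x :: w' then heat_density t (x - a) * tuple_density t c' w' else 1
  else 1.

Lemma tuple_density_ge0 t c w : 0 <= tuple_density t c w.
Proof.
elim: c w => [|a c IH] [|x w] //=.
by rewrite mulr_ge0 ?heat_density_ge0.
Qed.

Lemma measurable_heat_density t a :
  measurable_fun [set: RT] (fun x => heat_density t (x - a)).
Proof. by apply: continuous_measurable_fun; exact: continuous_heat_density. Qed.

Lemma measurable_tuple_density t m c : size c = m ->
  measurable_fun setT (fun w : m.-tuple RT => tuple_density t c w).
Proof.
elim: m c => [|m IH] [|a c] //= [sc].
apply: measurable_tuple_cons => /=; apply: measurable_funM.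
  exact: (measurableT_comp (measurable_heat_density t a) measurable_fst).
exact: (measurableT_comp (IH c sc) measurable_snd).
Qed.

Lemma integral_heat_density t a : 0 < t ->
  (\int[mu]_x (heat_density t (x - a))%:E = 1)%E.
Proof.
move=> t0; have := @ge0_integral_heat_density R (fun=> 1) t a t0.
under eq_integral do rewrite mul1r.
move=> ->//; last by move=> x; exact: cvg_cst.
have := @gauss_mean1 R; rewrite /gauss_mean /Rintegral => h.
by rewrite -[LHS]fineK ?h//; exact: integrable_fin_num (@gauss_integrable1 R).
Qed.

Lemma integral_tuple_density t m c : 0 < t -> size c = m ->
  (\int[lebesgue_power R m]_w (tuple_density t c w)%:E = 1)%E.
Proof.
move=> t0; elim: m c => [|m IH] [|a c] //= => [_|[sc]].
  by rewrite integral_dirac//= diracE mem_set// mul1e.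
rewrite /power_measureS ge0_integral_pushforward//=; last 3 first.
- exact: measurable_pair_cons.
- apply/measurable_EFinP; exact: (@measurable_tuple_density t m.+1 (a :: c) (congr1 S sc)).
- by move=> w _; rewrite lee_fin (tuple_density_ge0 t (a :: c)).
rewrite preimage_setT fubini_tonelli1//=; last 2 first.
- apply/measurable_EFinP; apply: measurable_funM.
    exact: (measurableT_comp (measurable_heat_density t a) measurable_fst).
  exact: (measurableT_comp (measurable_tuple_density t sc) measurable_snd).
- by move=> p; rewrite lee_fin mulr_ge0 ?heat_density_ge0 ?tuple_density_ge0.
rewrite -[RHS](integral_heat_density a t0); apply: eq_integral => x _.
rewrite /fubini_F /=; under eq_integral do rewrite EFinM.
rewrite ge0_integralZl//=.
- by rewrite IH// mule1.
- by apply/measurable_EFinP; exact: measurable_tuple_density.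
- by move=> w _; rewrite lee_fin tuple_density_ge0.
- by rewrite lee_fin heat_density_ge0.
Qed.

Lemma measurable_cons_tuple_density t a m c : size c = m ->
  measurable_fun setT (fun p : RT * m.-tuple RT =>
    heat_density t (p.1 - a) * tuple_density t c p.2).
Proof.
move=> sc; apply: measurable_funM.
  exact: (measurableT_comp (measurable_heat_density t a) measurable_fst).
exact: (measurableT_comp (measurable_tuple_density t sc) measurable_snd).
Qed.

Section Place.
Context {n : nat}.
Local Notation Cn := 'rV[R[i]]_n.
Implicit Types (u : Cn -> R) (z base : Cn) (ds : seq ('I_n * bool)).

Fixpoint place ds base (w : seq R) : Cn :=
  if ds is d :: ds' then
    if w is x :: w' then place ds' (shift base d x) w' else base
  else base.

Lemma place_shift ds base d x w :
  place ds (shift base d x) w = shift (place ds base w) d x.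
Proof.
elim: ds base w => [|d' ds IH] base [|y w] //=.
by rewrite -IH shiftAC.
Qed.

(** The function is continuous in each entry of the tuple separately, which
    gives joint measurability by induction on the number of entries. *)
Lemma measurable_place m ds base u : size ds = m -> dir_unif_cont u ->
  measurable_fun setT (fun w : m.-tuple RT => u (place ds base w)).
Proof.
move=> + cu; elim: m ds base => [|m IH] [|d ds] base //= [sd].
apply: measurable_tuple_cons => /=.
apply: (@caratheodory_measurable _ _
  (fun x (s : m.-tuple RT) => u (place ds (shift base d x) s))).
  by move=> x; exact: IH.
move=> s; under [X in continuous X]eq_fun do rewrite place_shift.
exact: dir_unif_cont_continuous.
Qed.

Lemma integrable_place m ds base u t c : 0 < t -> size ds = m -> size c = m ->
  buc 0 u ->
  (lebesgue_power R m).-integrable setT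
    (fun w => (u (place ds base w) * tuple_density t c w)%:E).
Proof.
move=> t0 sd sc bu; have [M uM] := buc_bounded bu.
have md := measurable_tuple_density t sc.
have h : (lebesgue_power R m).-integrable setT
    (fun w => (M%:E * (tuple_density t c w)%:E)%E).
  apply: integrableZl => //; apply/integrableP; split; first exact/measurable_EFinP.
  under eq_integral do rewrite /= ger0_norm ?tuple_density_ge0//.
  by rewrite integral_tuple_density// ltry.
apply: le_integrable h => //.
  apply/measurable_EFinP; apply: measurable_funM => //.
  exact: measurable_place (buc_unif_cont bu).
move=> w _ /=; rewrite lee_fin !(normrM _ (tuple_density _ _ _)).
by rewrite ler_wpM2r// (le_trans (uM _))// ler_norm.
Qed.

Lemma integrable_cons_place m d ds base u t a c :
  0 < t -> size ds = m -> size c = m -> buc 0 u ->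
  (mu \x lebesgue_power R m)%E.-integrable setT
    (fun p : RT * m.-tuple RT => (u (place ds (shift base d p.1) p.2) *
      (heat_density t (p.1 - a) * tuple_density t c p.2))%:E).
Proof.
move=> t0 sd sc bu; have [M uM] := buc_bounded bu.
have md := @measurable_cons_tuple_density t a m c sc.
have nneg (p : RT * m.-tuple RT) :
    0 <= heat_density t (p.1 - a) * tuple_density t c p.2.
  by rewrite mulr_ge0 ?heat_density_ge0 ?tuple_density_ge0.
have h : (mu \x lebesgue_power R m)%E.-integrable setT
    (fun p : RT * m.-tuple RT =>
     (M%:E * (heat_density t (p.1 - a) * tuple_density t c p.2)%:E)%E).
  apply: integrableZl => //; apply/integrableP; split; first exact/measurable_EFinP.
  under eq_integral => p _ do rewrite /= ger0_norm ?nneg//.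
  have := @integral_tuple_density t m.+1 (a :: c) t0 (congr1 S sc).
  rewrite /= /power_measureS ge0_integral_pushforward//=; last 3 first.
  - exact: measurable_pair_cons.
  - apply/measurable_EFinP; exact: (@measurable_tuple_density t m.+1 (a :: c) (congr1 S sc)).
  - by move=> w _; rewrite lee_fin (tuple_density_ge0 t (a :: c)).
  by rewrite preimage_setT => ->; rewrite ltry.
apply: le_integrable h => //.
  apply/measurable_EFinP; apply: measurable_funM => //.
  apply: (@caratheodory_measurable _ _
    (fun x (s : m.-tuple RT) => u (place ds (shift base d x) s))).
    by move=> x; apply: measurable_place => //; exact: buc_unif_cont bu.
  move=> s; under [X in continuous X]eq_fun do rewrite place_shift.
  exact/dir_unif_cont_continuous/(buc_unif_cont bu).
move=> p _ /=; rewrite lee_fin !(normrM _ (_ * _)).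
by rewrite ler_wpM2r// (le_trans (uM _))// ler_norm.
Qed.

(** Fubini peels off the first coordinate; in it the density is centred at [a]
    and has variance proportional to [t], so that translation and dilation turn
    the integral into the one-dimensional Gaussian mean. *)
Lemma Rintegral_place m ds base u t c : 0 < t -> size ds = m -> size c = m ->
  buc 0 u ->
  \int[lebesgue_power R m]_w (u (place ds base w) * tuple_density t c w) =
  heat_along ds t u (place ds base c).
Proof.
move=> t0; elim: m ds base c => [|m IH] [|d ds] base [|a c] // => [_ _ bu|[sd] [sc] bu].
  rewrite /Rintegral [lebesgue_power R 0]/= integral_dirac//=.
  by rewrite indicE mem_set// mul1r mulr1.
have mf : measurable_fun setT (fun w : m.+1.-tuple RT =>
    u (place (d :: ds) base w) * tuple_density t (a :: c) w).
  apply: measurable_funM; last exact: (@measurable_tuple_density t m.+1 (a :: c) (congr1 S sc)).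
  exact: (@measurable_place m.+1 (d :: ds) base u (congr1 S sd) (buc_unif_cont bu)).
have ic := integrable_cons_place d base a t0 sd sc bu.
rewrite /Rintegral [lebesgue_power R m.+1]/= /power_measureS.
rewrite integral_pushforward//; last 2 first.
- exact: measurable_pair_cons.
- exact/measurable_EFinP.
rewrite preimage_setT -integral12_prod_meas1//.
have bh := heat_along_buc ds t bu; have [M hM] := buc_bounded bh.
set z0 := place ds base c.
have -> : (\int[mu]_x fubini_F (lebesgue_power R m)
      ((fun w => (u (place (d :: ds) base w) * tuple_density t (a :: c) w)%:E)
        \o @pair_cons _ RT m) x =
    \int[mu]_x (heat_along ds t u (shift z0 d x) * heat_density t (x - a))%:E)%E.
  apply: eq_integral => x _; rewrite /fubini_F /=.
  under eq_integral do rewrite mulrCA EFinM.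
  have ip := integrable_place (shift base d x) t0 sd sc bu.
  rewrite integralZl//.
  have := IH ds (shift base d x) c sd sc bu; rewrite /Rintegral place_shift -/z0 => <-.
  by rewrite [RHS]EFinM [RHS]muleC fineK//; exact: integrable_fin_num.
rewrite -[LHS]/(\int[mu]_x (heat_along ds t u (shift z0 d x) * heat_density t (x - a))).
rewrite (@Rintegral_heat_density _ _ M)//; last first.
  exact/dir_unif_cont_continuous/(buc_unif_cont bh).
rewrite /= place_shift -/z0 /line_heat; congr gauss_mean; apply/funext => y.
by rewrite shift_shift.
Qed.

End Place.

End PowerMeasureHeat.

(** * The heat transform as an iterated flow *)

Section HeatTransformIsIterated.
Context {R : realType} {n : nat}.
Local Notation Cn := 'rV[R[i]]_n.
Implicit Types (u : Cn -> R) (z base : Cn) (h : Cn -> R[i]).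

(** In the order in which [Cn_of_tuple] reads its tuple. *)
Definition coord_dirs : seq ('I_n * bool) :=
  [seq (j, false) | j <- enum 'I_n] ++ [seq (j, true) | j <- enum 'I_n].

Definition coords z : seq R :=
  [seq complex.Re (z ord0 j) | j <- enum 'I_n] ++
  [seq complex.Im (z ord0 j) | j <- enum 'I_n].

Lemma place_cat ds1 ds2 base (w1 w2 : seq R) : size ds1 = size w1 ->
  place (ds1 ++ ds2) base (w1 ++ w2) = place ds2 (place ds1 base w1) w2.
Proof. by elim: ds1 base w1 => [|d ds IH] base [|x w] //= [/IH]. Qed.

Lemma place_map (b : bool) (x : 'I_n -> R) (s : seq 'I_n) base :
  place [seq (j, b) | j <- s] base [seq x j | j <- s] =
  base + \sum_(j <- s) ((x j)%:C)%C *: real_dir R (j, b).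
Proof.
elim: s base => [|j s IH] base /=; first by rewrite big_nil addr0.
by rewrite IH big_cons shift.unlock addrA.
Qed.

Lemma sum_real_dir (b : bool) (x : 'I_n -> R) k :
  (\sum_(j <- enum 'I_n) ((x j)%:C)%C *: real_dir R (j, b)) ord0 k =
  if b then (0 +i* x k)%C else ((x k)%:C)%C.
Proof.
have E j : (((x j)%:C)%C *: real_dir R (j, b)) ord0 k =
    if j == k then (if b then (0 +i* x k)%C else ((x k)%:C)%C) else 0.
  rewrite /real_dir /= [LHS]mxE [X in _ * X]mxE [X in _ * (_ * X)]mxE eqxx /=.
  rewrite [k == j]eq_sym; have [<-|_] := eqVneq j k; last by rewrite !mulr0.
  by case: b; rewrite !mulr1; simpc.
rewrite summxE big_enum /=.
by under eq_bigr do rewrite E; rewrite -big_mkcond big_pred1_eq.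
Qed.

Lemma place_coords z : place coord_dirs 0 (coords z) = z.
Proof.
rewrite place_cat ?size_map// !place_map add0r.
apply/rowP => k; rewrite mxE !sum_real_dir.
by case: (z ord0 k) => a b; simpc.
Qed.

Lemma size_coords z : size (coords z) = (n + n)%N.
Proof. by rewrite size_cat !(size_map _ (enum 'I_n)) size_enum_ord. Qed.

Lemma size_coord_dirs : size coord_dirs = (n + n)%N.
Proof. by rewrite size_cat !(size_map _ (enum 'I_n)) size_enum_ord. Qed.

Lemma coords_Cn_of_tuple (w : (n + n).-tuple (measurableTypeR R)) :
  coords (Cn_of_tuple w) = w.
Proof.
apply: (@eq_from_nth _ 0); rewrite size_coords ?size_tuple// => i i2n.
rewrite /coords nth_cat (size_map _ (enum 'I_n)) size_enum_ord.
have [lt_in|le_ni] := ltnP i n.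
  rewrite (nth_map (Ordinal lt_in)) ?size_enum_ord// mxE /= (tnth_nth 0) /=.
  by rewrite nth_enum_ord.
have lt_in : (i - n < n)%N by rewrite ltn_subLR.
rewrite (nth_map (Ordinal lt_in)) ?size_enum_ord// mxE /= (tnth_nth 0) /=.
by rewrite nth_enum_ord// subnKC.
Qed.

Lemma Cn_of_tuple_place (w : (n + n).-tuple (measurableTypeR R)) :
  Cn_of_tuple w = place coord_dirs 0 w.
Proof. by rewrite -(coords_Cn_of_tuple w) place_coords. Qed.

Lemma tuple_density_cat t (c1 c2 w1 w2 : seq R) : size c1 = size w1 ->
  tuple_density t (c1 ++ c2) (w1 ++ w2) =
  tuple_density t c1 w1 * tuple_density t c2 w2.
Proof.
elim: c1 w1 => [|a c IH] [|x w] //= => [_|[/IH ->]]; first by rewrite mul1r.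
by rewrite mulrA.
Qed.

Lemma tuple_density_map t (a x : 'I_n -> R) (s : seq 'I_n) :
  tuple_density t [seq a j | j <- s] [seq x j | j <- s] =
  (Num.sqrt (t * pi))^-1 ^+ size s *
  expR (- ((\sum_(j <- s) (x j - a j) ^+ 2) / t)).
Proof.
elim: s => [|j s IH] /=; first by rewrite big_nil mul0r oppr0 expR0 expr0 mulr1.
by rewrite IH big_cons /heat_density mulrDl opprD expRD (exprS _ (size s)) mulrACA.
Qed.

Lemma enorm_sqr z : enorm z ^+ 2 =
  \sum_(j <- enum 'I_n) complex.Re (z ord0 j) ^+ 2 +
  \sum_(j <- enum 'I_n) complex.Im (z ord0 j) ^+ 2.
Proof.
rewrite /enorm sqr_sqrtr; last by apply: sumr_ge0 => j _; exact: sqr_ge0.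
rewrite !big_enum -big_split /=; apply: eq_bigr => j _.
by case: (z ord0 j) => a b /=; rewrite sqr_sqrtr// addr_ge0 ?sqr_ge0.
Qed.

Lemma tuple_density_coords t (z w : Cn) : 0 < t ->
  tuple_density t (coords z) (coords w) =
  (t * pi) ^- n * expR (- (enorm (w - z) ^+ 2 / t)).
Proof.
move=> t0; rewrite tuple_density_cat ?size_map// !tuple_density_map.
rewrite size_enum_ord mulrACA -exprMn -expRD; congr (_ * expR _).
  by rewrite -invfM -expr2 sqr_sqrtr ?mulr_ge0 ?pi_ge0 ?ltW// exprVn.
rewrite enorm_sqr mulrDl opprD; congr (- (_ / _) + - (_ / _));
  apply: eq_bigr => j _; rewrite !mxE;
  by case: (w ord0 j) (z ord0 j) => [a b] [a' b'].
Qed.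

Lemma Rintegral_gaussian_weight u t z : 0 < t -> buc 0 u ->
  (t * pi) ^- n * \int[lebesgue_power R (n + n)]_w
    (u (Cn_of_tuple w) * expR (- (enorm (Cn_of_tuple w - z) ^+ 2 / t))) =
  heat_along coord_dirs t u z.
Proof.
move=> t0 bu.
have := Rintegral_place 0 t0 size_coord_dirs (size_coords z) bu.
rewrite place_coords => <-.
have tpi : (t * pi) ^- n != 0 by rewrite invr_eq0 expf_neq0// mulf_neq0 ?gt_eqF ?pi_gt0.
have E w : u (Cn_of_tuple w) * expR (- (enorm (Cn_of_tuple w - z) ^+ 2 / t)) =
    ((t * pi) ^- n)^-1 * (u (place coord_dirs 0 w) * tuple_density t (coords z) w).
  rewrite -[in tuple_density _ _ _](coords_Cn_of_tuple w) tuple_density_coords// -Cn_of_tuple_place.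
  by rewrite [in RHS]mulrCA mulKf.
under eq_Rintegral do rewrite E.
rewrite RintegralZl ?mulVKf//.
exact: integrable_place t0 size_coord_dirs (size_coords z) bu.
Qed.

Definition re_part h z : R := complex.Re (h z).

Definition im_part h z : R := complex.Im (h z).

Lemma heat_transformE h (t : R) z : 0 < t ->
  buc 0 (re_part h) -> buc 0 (im_part h) ->
  heat_transform t h z = (heat_along coord_dirs t (re_part h) z +i*
    heat_along coord_dirs t (im_part h) z)%C.
Proof.
move=> t0 bR bI; rewrite -!Rintegral_gaussian_weight// /re_part /im_part.
rewrite /heat_transform /Cn_integral.
have E1 (c : R[i]) r : complex.Re (c * (r%:C)%C) = complex.Re c * r.
  by case: c => a b; rewrite /= mulr0 subr0.
have E2 (c : R[i]) r : complex.Im (c * (r%:C)%C) = complex.Im c * r.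
  by case: c => a b; rewrite /= mulr0 add0r.
under eq_Rintegral do rewrite E1.
under [X in (_ +i* X)%C]eq_Rintegral do rewrite E2.
by simpc.
Qed.

End HeatTransformIsIterated.

(** * Wirtinger calculus *)

Local Open Scope complex_scope.

(** Locked, to keep iterated derivatives folded. *)
HB.lock Definition cpartial (R : realType) (n : nat) (d : 'I_n * bool)
    (h : 'rV[R[i]]_n -> R[i]) : 'rV[R[i]]_n -> R[i] := rpartial d h.

Section ComplexCalculus.
Context {R : realType} {n : nat}.
Local Notation C := R[i].
Local Notation Cn := 'rV[R[i]]_n.
Local Notation normc := (@Normc.normc R).
Implicit Types (h g : Cn -> C) (z : Cn) (d : 'I_n * bool) (s t M e : R) (a b c : C).

Lemma normc_ge_abs_Re c : `|complex.Re c| <= normc c.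
Proof.
by case: c => x y /=; rewrite -sqrtr_sqr ler_sqrt ?lerDl ?sqr_ge0 ?addr_ge0 ?sqr_ge0.
Qed.

Lemma normc_ge_abs_Im c : `|complex.Im c| <= normc c.
Proof.
by case: c => x y /=; rewrite -sqrtr_sqr ler_sqrt ?lerDr ?sqr_ge0 ?addr_ge0 ?sqr_ge0.
Qed.

Lemma normc_le_abs c : normc c <= `|complex.Re c| + `|complex.Im c|.
Proof.
case: c => x y /=; rewrite -[leRHS]ger0_norm ?addr_ge0// -sqrtr_sqr ler_sqrt ?sqr_ge0//.
rewrite sqrrD !real_normK ?num_real// addrAC lerDl.
by rewrite mulrn_wge0// mulr_ge0.
Qed.

Lemma normc_ge0 c : 0 <= normc c.
Proof. by case: c => x y; exact: sqrtr_ge0. Qed.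

Lemma normc_real (x : R) : normc x%:C = `|x|.
Proof. by rewrite /= expr0n addr0 sqrtr_sqr. Qed.

Lemma ReD a b : complex.Re (a + b) = complex.Re a + complex.Re b.
Proof. by case: a b => [? ?] [? ?]. Qed.

Lemma ImD a b : complex.Im (a + b) = complex.Im a + complex.Im b.
Proof. by case: a b => [? ?] [? ?]. Qed.

Lemma ReB a b : complex.Re (a - b) = complex.Re a - complex.Re b.
Proof. by case: a b => [? ?] [? ?]. Qed.

Lemma ImB a b : complex.Im (a - b) = complex.Im a - complex.Im b.
Proof. by case: a b => [? ?] [? ?]. Qed.

Lemma ReM a b : complex.Re (a * b) =
  complex.Re a * complex.Re b + (-1) * (complex.Im a * complex.Im b).
Proof. by case: a b => [? ?] [? ?] /=; rewrite mulN1r. Qed.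

Lemma ImM a b : complex.Im (a * b) =
  complex.Re a * complex.Im b + complex.Im a * complex.Re b.
Proof. by case: a b => [? ?] [? ?] /=; rewrite addrC. Qed.

Lemma complex_eqP a b :
  complex.Re a = complex.Re b -> complex.Im a = complex.Im b -> a = b.
Proof. by case: a b => [? ?] [? ?] /= -> ->. Qed.

Definition cbuc m h := buc m (re_part h) /\ buc m (im_part h).

Lemma cpartialE d h z :
  cpartial d h z = partial d (re_part h) z +i* partial d (im_part h) z.
Proof.
rewrite cpartial.unlock /rpartial /partial /re_part /im_part.
have -> : along h d z = (fun s => h (shift z d s)) by apply/funext => s; exact: along_shift.
by [].
Qed.

Lemma re_cpartial d h : re_part (cpartial d h) = partial d (re_part h).
Proof. by apply/funext => z; rewrite /re_part cpartialE. Qed.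

Lemma im_cpartial d h : im_part (cpartial d h) = partial d (im_part h).
Proof. by apply/funext => z; rewrite /im_part cpartialE. Qed.

Lemma cbuc_cpartial m d h : cbuc m.+1 h -> cbuc m (cpartial d h).
Proof.
by move=> [hR hI]; split; rewrite ?re_cpartial ?im_cpartial; exact: buc_partial.
Qed.

Lemma cbuc_le m m' h : (m <= m')%N -> cbuc m' h -> cbuc m h.
Proof. by move=> mm' [hR hI]; split; exact: buc_le mm' _. Qed.

Lemma cbucW m h : cbuc m.+1 h -> cbuc m h.
Proof. exact: cbuc_le. Qed.

Lemma cbuc0 m h : cbuc m h -> cbuc 0 h.
Proof. exact: cbuc_le. Qed.

Lemma cbucD m h g : cbuc m h -> cbuc m g -> cbuc m (fun z => h z + g z).
Proof.
move=> [hR hI] [gR gI]; split; rewrite /re_part /im_part.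
  by under eq_fun do rewrite ReD; exact: bucD.
by under eq_fun do rewrite ImD; exact: bucD.
Qed.

Lemma cbucM m h g : cbuc m h -> cbuc m g -> cbuc m (fun z => h z * g z).
Proof.
move=> [hR hI] [gR gI]; split; rewrite /re_part /im_part.
  under eq_fun do rewrite ReM; apply: bucD; first exact: bucM.
  by apply: bucZ; exact: bucM.
by under eq_fun do rewrite ImM; apply: bucD; exact: bucM.
Qed.

Lemma cbuc_cst m c : cbuc m (fun=> c).
Proof. by split; exact: buc_cst. Qed.

Lemma cbucZ m c h : cbuc m h -> cbuc m (fun z => c * h z).
Proof. by move=> bh; apply: cbucM bh; exact: cbuc_cst. Qed.

Lemma cbuc_bounded m h : cbuc m h -> exists2 M, 0 < M & forall z, normc (h z) <= M.
Proof.
move=> [/buc_bounded/bounded_fun_pos[M M0 hM] /buc_bounded/bounded_fun_pos[N N0 hN]].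
exists (M + N) => [|z]; first by rewrite addr_gt0.
exact: le_trans (normc_le_abs _) (lerD (hM z) (hN z)).
Qed.

Lemma cpartialD m d h g : cbuc m.+1 h -> cbuc m.+1 g ->
  cpartial d (fun z => h z + g z) = (fun z => cpartial d h z + cpartial d g z).
Proof.
move=> [hR hI] [gR gI]; apply/funext => z; rewrite !cpartialE.
have -> : re_part (fun z => h z + g z) = (fun z => re_part h z + re_part g z).
  by apply/funext => x; exact: ReD.
have -> : im_part (fun z => h z + g z) = (fun z => im_part h z + im_part g z).
  by apply/funext => x; exact: ImD.
by rewrite (partialD _ hR gR) (partialD _ hI gI).
Qed.

Lemma re_partM h g : re_part (fun z => h z * g z) =
  (fun z => re_part h z * re_part g z + (-1) * (im_part h z * im_part g z)).
Proof. by apply/funext => z; exact: ReM. Qed.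

Lemma im_partM h g : im_part (fun z => h z * g z) =
  (fun z => re_part h z * im_part g z + im_part h z * re_part g z).
Proof. by apply/funext => z; exact: ImM. Qed.

Lemma cpartialM m d h g : cbuc m.+1 h -> cbuc m.+1 g ->
  cpartial d (fun z => h z * g z) =
  (fun z => cpartial d h z * g z + h z * cpartial d g z).
Proof.
move=> [hR hI] [gR gI]; apply/funext => z; rewrite !cpartialE re_partM im_partM.
rewrite (partialD _ (bucM hR gR) (bucZ (-1) (bucM hI gI))).
rewrite (partialD _ (bucM hR gI) (bucM hI gR)) (partialZ _ _ (bucM hI gI)).
rewrite (partialM _ hR gR) (partialM _ hI gI) (partialM _ hR gI) (partialM _ hI gR).
apply: complex_eqP; rewrite ?ReD ?ImD ?ReM ?ImM /= /re_part /im_part; ring.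
Qed.

Lemma cpartial_cst d c : cpartial d (fun=> c) = (fun=> 0).
Proof.
apply/funext => z; rewrite cpartialE.
by rewrite !(has_partialE (has_partial_cst _ _)).
Qed.

Lemma cpartialZ m d c h : cbuc m.+1 h ->
  cpartial d (fun z => c * h z) = (fun z => c * cpartial d h z).
Proof.
move=> bh; rewrite (cpartialM _ (cbuc_cst m.+1 c) bh) cpartial_cst.
by apply/funext => z; rewrite mul0r add0r.
Qed.

Lemma cpartialC m d d' h : cbuc m.+2 h ->
  cpartial d' (cpartial d h) = cpartial d (cpartial d' h).
Proof.
move=> [hR hI]; apply/funext => z.
have E (b b' : 'I_n * bool) : cpartial b' (cpartial b h) z =
    partial b' (partial b (re_part h)) z +i* partial b' (partial b (im_part h)) z.
  by rewrite cpartialE re_cpartial im_cpartial.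
apply: etrans (E d d') _; apply: etrans (esym (E d' d)).
exact: (congr2 (fun u v => u z +i* v z) (partialC d d' hR) (partialC d d' hI)).
Qed.

Lemma wirt_algebraD (k c x1 x2 y1 y2 : C) :
  k * (x1 + x2 + c * (y1 + y2)) = k * (x1 + c * y1) + k * (x2 + c * y2).
Proof. by ring. Qed.

Lemma wirt_algebraM (k c x1 x2 y1 y2 u v : C) :
  k * (x1 * v + u * x2 + c * (y1 * v + u * y2)) =
  k * (x1 + c * y1) * v + u * (k * (x2 + c * y2)).
Proof. by ring. Qed.

Lemma wirt_algebraC (k c c' x1 x2 x3 x4 : C) :
  k * (k * (x1 + c' * x2) + c * (k * (x3 + c' * x4))) =
  k * (k * (x1 + c * x3) + c' * (k * (x2 + c * x4))).
Proof. by ring. Qed.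

(** Both Wirtinger operators at once: [c] is -i for the holomorphic derivative
    and i for the antiholomorphic one. *)
Definition wirt c (j : 'I_n) h z : C :=
  2^-1 * (cpartial (j, false) h z + c * cpartial (j, true) h z).

Lemma wirtingerE j : wirtinger j = wirt (- 'i%C) j.
Proof.
by apply/funext => h; apply/funext => z; rewrite /wirt cpartial.unlock mulNr.
Qed.

Lemma wirtinger_barE j : wirtinger_bar j = wirt 'i%C j.
Proof. by apply/funext => h; apply/funext => z; rewrite /wirt cpartial.unlock. Qed.

Lemma cbuc_wirt m c j h : cbuc m.+1 h -> cbuc m (wirt c j h).
Proof.
move=> bh; apply: cbucZ; apply: cbucD; first exact: cbuc_cpartial.
by apply: cbucZ; exact: cbuc_cpartial.
Qed.

Lemma wirtD m c j h g : cbuc m.+1 h -> cbuc m.+1 g ->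
  wirt c j (fun z => h z + g z) = (fun z => wirt c j h z + wirt c j g z).
Proof.
move=> bh bg; apply/funext => z; rewrite /wirt.
rewrite (cpartialD (j, false) bh bg) (cpartialD (j, true) bh bg).
exact: wirt_algebraD.
Qed.

Lemma wirtM m c j h g : cbuc m.+1 h -> cbuc m.+1 g ->
  wirt c j (fun z => h z * g z) = (fun z => wirt c j h z * g z + h z * wirt c j g z).
Proof.
move=> bh bg; apply/funext => z; rewrite /wirt.
rewrite (cpartialM (j, false) bh bg) (cpartialM (j, true) bh bg).
exact: wirt_algebraM.
Qed.

Lemma cpartial_wirt m d c j h : cbuc m.+2 h ->
  cpartial d (wirt c j h) = wirt c j (cpartial d h).
Proof.
move=> bh; apply/funext => z; rewrite /wirt.
have b1 := cbuc_cpartial (j, false) bh; have b2 := cbuc_cpartial (j, true) bh.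
rewrite (cpartialZ d _ (cbucD b1 (cbucZ c b2))) (cpartialD d b1 (cbucZ c b2)).
by rewrite (cpartialZ d c b2) (cpartialC (j, false) d bh) (cpartialC (j, true) d bh).
Qed.

Lemma wirtC m c c' j j' h : cbuc m.+2 h ->
  wirt c j (wirt c' j' h) = wirt c' j' (wirt c j h).
Proof.
move=> bh; apply/funext => z; rewrite [LHS]/wirt.
rewrite (cpartial_wirt (j, false) c' j' bh) (cpartial_wirt (j, true) c' j' bh).
have b1 := cbuc_cpartial (j, false) bh; have b2 := cbuc_cpartial (j, true) bh.
rewrite [in RHS]/wirt.
rewrite [in RHS](cpartialZ (j', false) _ (cbucD b1 (cbucZ c b2))).
rewrite [in RHS](cpartialZ (j', true) _ (cbucD b1 (cbucZ c b2))).
rewrite [in RHS](cpartialD (j', false) b1 (cbucZ c b2)).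
rewrite [in RHS](cpartialD (j', true) b1 (cbucZ c b2)).
rewrite [in RHS](cpartialZ (j', false) c b2) [in RHS](cpartialZ (j', true) c b2).
exact: wirt_algebraC.
Qed.

End ComplexCalculus.

(** * The heat flow of complex functions *)

(** For positive [t] this is [heat_transform] on functions of class [cbuc]; at
    [t = 0] it is the identity. *)
HB.lock Definition cplx_heat (R : realType) (n : nat) (t : R)
    (h : 'rV[R[i]]_n -> R[i]) (z : 'rV[R[i]]_n) : R[i] :=
  heat_along coord_dirs t (re_part h) z +i* heat_along coord_dirs t (im_part h) z.

Section ComplexHeat.
Context {R : realType} {n : nat}.
Local Notation C := R[i].
Local Notation Cn := 'rV[R[i]]_n.
Local Notation normc := (@Normc.normc R).
Implicit Types (h g : Cn -> C) (z : Cn) (d : 'I_n * bool) (s t M e : R) (a b c : C).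

Lemma enorm_shift z d s : enorm (shift z d s - z) = `|s|.
Proof.
rewrite shift.unlock addrAC subrr add0r /enorm -sqrtr_sqr; congr Num.sqrt.
case: d => j b; rewrite (bigD1 j)//= big1 => [|k kj].
  rewrite addr0 !mxE !eqxx mulr1 Normc.normcM normc_real exprMn.
  rewrite real_normK ?num_real//.
  by case: b => /=; rewrite ?expr1n ?expr0n /= ?add0r ?addr0 sqrtr1 expr1n mulr1.
by rewrite !mxE (negPf kj) andbF !mulr0 Normc.normc0 expr0n.
Qed.

Lemma C_buc_cbuc m h : C_buc m h -> cbuc m h.
Proof.
have unif h' : unif_cont_on_Cn h' ->
    dir_unif_cont (re_part h') /\ dir_unif_cont (im_part h').
  move=> uh; split=> d e e0; have [r r0 hr] := uh e e0; exists r => // z s sr;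
    have := hr (shift z d s) z; rewrite enorm_shift => /(_ sr); apply: le_lt_trans.
    by rewrite /re_part -ReB; exact: normc_ge_abs_Re.
  by rewrite /im_part -ImB; exact: normc_ge_abs_Im.
have bnd h' : bounded_on_Cn h' ->
    bounded_fun (re_part h') /\ bounded_fun (im_part h').
  move=> [M hM]; split; exists M => z; apply: le_trans (hM z).
    exact: normc_ge_abs_Re.
  exact: normc_ge_abs_Im.
elim: m h => [|m IHm] h Ch.
  have [_ /bnd[b1 b2] /unif[u1 u2]] := Ch [::] isT.
  by split; split.
have [dh /bnd[b1 b2] /unif[u1 u2]] := Ch [::] isT.
have Cd d : C_buc m (rpartial d h).
  move=> s sm; have := Ch (rcons s d); rewrite size_rcons ltnS => /(_ sm).
  by rewrite /rpartials foldr_rcons.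
have rpE d : rpartial d h = cpartial d h by rewrite cpartial.unlock.
have along_E d z : along h d z = (fun s => h (shift z d s)).
  by apply/funext => s; exact: along_shift.
split; split => //; split => [d z|d].
- by have [+ _] := dh isT d z; rewrite /= along_E.
- by have [+ _] := IHm _ (Cd d); rewrite rpE re_cpartial.
- by have [_ +] := dh isT d z; rewrite /= along_E.
- by have [_ +] := IHm _ (Cd d); rewrite rpE im_cpartial.
Qed.

Lemma heat_transform_cplx_heat t h : 0 < t -> cbuc 0 h -> heat_transform t h = cplx_heat t h.
Proof.
by move=> t0 [hR hI]; apply/funext => z; rewrite cplx_heat.unlock heat_transformE.
Qed.

Lemma re_cplx_heat t h : re_part (cplx_heat t h) = heat_along coord_dirs t (re_part h).
Proof. by apply/funext => z; rewrite cplx_heat.unlock. Qed.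

Lemma im_cplx_heat t h : im_part (cplx_heat t h) = heat_along coord_dirs t (im_part h).
Proof. by apply/funext => z; rewrite cplx_heat.unlock. Qed.

Lemma cplx_heat_ext t h g z : 
  heat_along coord_dirs t (re_part h) z = re_part g z ->
  heat_along coord_dirs t (im_part h) z = im_part g z -> cplx_heat t h z = g z.
Proof. by move=> hR hI; rewrite cplx_heat.unlock hR hI /re_part /im_part; case: (g z). Qed.

Lemma cplx_heatD m t h g : cbuc m h -> cbuc m g ->
  cplx_heat t (fun z => h z + g z) = (fun z => cplx_heat t h z + cplx_heat t g z).
Proof.
move=> [hR hI] [gR gI]; apply/funext => z.
apply: (@cplx_heat_ext t _ (fun z => cplx_heat t h z + cplx_heat t g z)).
  have -> : re_part (fun z => h z + g z) = (fun z => re_part h z + re_part g z).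
    by apply/funext => x; exact: ReD.
  by rewrite (heat_alongD _ _ hR gR) cplx_heat.unlock.
have -> : im_part (fun z => h z + g z) = (fun z => im_part h z + im_part g z).
  by apply/funext => x; exact: ImD.
by rewrite (heat_alongD _ _ hI gI) cplx_heat.unlock.
Qed.

Lemma cplx_heatZ m t c h : cbuc m h ->
  cplx_heat t (fun z => c * h z) = (fun z => c * cplx_heat t h z).
Proof.
move=> [hR hI]; apply/funext => z.
apply: (@cplx_heat_ext t _ (fun z => c * cplx_heat t h z)).
  have -> : re_part (fun z => c * h z) =
      (fun z => complex.Re c * re_part h z + - complex.Im c * im_part h z).
    by apply/funext => x; rewrite /re_part /im_part ReM mulN1r mulNr.
  rewrite (heat_alongD _ _ (bucZ _ hR) (bucZ _ hI)) !(heat_alongZ _ _ _ hR).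
  by rewrite (heat_alongZ _ _ _ hI) /re_part ReM mulN1r mulNr cplx_heat.unlock.
have -> : im_part (fun z => c * h z) =
    (fun z => complex.Re c * im_part h z + complex.Im c * re_part h z).
  by apply/funext => x; rewrite /re_part /im_part ImM.
rewrite (heat_alongD _ _ (bucZ _ hI) (bucZ _ hR)) !(heat_alongZ _ _ _ hR).
by rewrite (heat_alongZ _ _ _ hI) /im_part ImM cplx_heat.unlock.
Qed.

Lemma cplx_heat_cpartial m t d h : cbuc m.+1 h ->
  cpartial d (cplx_heat t h) = cplx_heat t (cpartial d h).
Proof.
move=> [hR hI]; apply/funext => z; apply/esym/cplx_heat_ext; apply/esym.
  by rewrite re_cpartial re_cplx_heat re_cpartial (heat_along_partial _ t d hR).
by rewrite im_cpartial im_cplx_heat im_cpartial (heat_along_partial _ t d hI).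
Qed.

Lemma cplx_heat_wirt m t c j h : cbuc m.+1 h ->
  wirt c j (cplx_heat t h) = cplx_heat t (wirt c j h).
Proof.
move=> bh; have b1 := cbuc_cpartial (j, false) bh; have b2 := cbuc_cpartial (j, true) bh.
rewrite /wirt (cplx_heatZ t _ (cbucD b1 (cbucZ c b2))) (cplx_heatD t b1 (cbucZ c b2)).
rewrite (cplx_heatZ t c b2) (cplx_heat_cpartial t (j, false) bh).
by rewrite (cplx_heat_cpartial t (j, true) bh).
Qed.

(** Continuity in time at 0, where each one-dimensional average is the
    identity. *)
Lemma cplx_heat_cvg0 h e : cbuc 0 h -> 0 < e -> exists2 r : R, 0 < r &
  forall t, 0 < t < r -> forall z, normc (cplx_heat t h z - h z) <= e.
Proof.
have zero u : heat_along (@coord_dirs n) 0 u = u.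
  elim: coord_dirs => //= d ds ->; apply/funext => z; rewrite /line_heat sqrtr0.
  by under eq_fun do rewrite mul0r shift0; rewrite gauss_mean_cst.
move=> [hR hI] e0; have e2 : 0 < e / 2 by rewrite divr_gt0.
have [r1 r10 h1] := heat_along_time_cont coord_dirs hR (lexx 0) e2.
have [r2 r20 h2] := heat_along_time_cont coord_dirs hI (lexx 0) e2.
exists (Num.min r1 r2) => [|t /andP[t0]]; first by rewrite lt_min r10.
rewrite lt_min => /andP[tr1 tr2] z.
rewrite [e]splitr; apply: le_trans (normc_le_abs _) _; apply: lerD.
  have := h1 t (ltW t0); rewrite subr0 gtr0_norm// => /(_ tr1 z).
  by rewrite zero ReB cplx_heat.unlock.
have := h2 t (ltW t0); rewrite subr0 gtr0_norm// => /(_ tr2 z).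
by rewrite zero ImB cplx_heat.unlock.
Qed.

Lemma cplx_heat_bounded h : cbuc 0 h -> exists2 M, 0 < M &
  forall t z, normc (cplx_heat t h z) <= M.
Proof.
move=> [hR hI].
have [M M0 hM] := bounded_fun_pos (buc_bounded hR).
have [N N0 hN] := bounded_fun_pos (buc_bounded hI).
exists (M + N) => [|t z]; first by rewrite addr_gt0.
apply: le_trans (normc_le_abs _) _; rewrite cplx_heat.unlock /=; apply: lerD.
  exact: heat_along_bound hR hM z.
exact: heat_along_bound hI hN z.
Qed.

End ComplexHeat.

(** * The Laplacian and the complex heat equation *)

Section ComplexLaplacian.
Context {R : realType} {n : nat}.
Local Notation C := R[i].
Local Notation Cn := 'rV[R[i]]_n.
Local Notation normc := (@Normc.normc R).
Local Notation dz := (wirt (- 'i%C)).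
Local Notation dzb := (wirt 'i%C).
Implicit Types (h g : Cn -> C) (z : Cn) (d : 'I_n * bool) (s t M e : R) (a b c : C).

Definition wirt_laplacian h z : C := \sum_(j < n) dz j (dzb j h) z.

Lemma wirt_algebra_laplacian (x y w : C) :
  2^-1 * (2^-1 * (x + 'i%C * y) + - 'i%C * (2^-1 * (y + 'i%C * w))) =
  4^-1 * (x + w).
Proof.
have i2 : 'i%C * 'i%C = -1 :> C by rewrite -expr2 sqr_i.
have -> : 4^-1 = 2^-1 * 2^-1 :> C by rewrite -invfM -natrM.
transitivity (2^-1 * 2^-1 * (x - 'i%C * 'i%C * w)); first by ring.
by rewrite i2 mulN1r opprK.
Qed.

(** The two mixed second derivatives cancel by symmetry. *)
Lemma dz_dzb m j h z : cbuc m.+2 h -> dz j (dzb j h) z =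
  4^-1 * (cpartial (j, false) (cpartial (j, false) h) z +
          cpartial (j, true) (cpartial (j, true) h) z).
Proof.
move=> bh; rewrite [LHS]/wirt.
rewrite (cpartial_wirt (j, false) 'i%C j bh) (cpartial_wirt (j, true) 'i%C j bh).
rewrite /wirt (cpartialC (j, false) (j, true) bh).
exact: wirt_algebra_laplacian.
Qed.

Lemma quarter_laplacianE ds (u : Cn -> R) z :
  quarter_laplacian ds u z = \sum_(d <- ds) 4^-1 * partial d (partial d u) z.
Proof. by elim: ds => [|d ds IH] /=; rewrite ?big_nil// big_cons IH. Qed.

Lemma Re_sum (I : Type) (r : seq I) (F : I -> C) :
  complex.Re (\sum_(i <- r) F i) = \sum_(i <- r) complex.Re (F i).
Proof. by elim/big_rec2: _ => // i x y _ <-; rewrite ReD. Qed.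

Lemma Im_sum (I : Type) (r : seq I) (F : I -> C) :
  complex.Im (\sum_(i <- r) F i) = \sum_(i <- r) complex.Im (F i).
Proof. by elim/big_rec2: _ => // i x y _ <-; rewrite ImD. Qed.

Lemma big_coord_dirs (F : 'I_n * bool -> R) :
  \sum_(d <- coord_dirs) F d = \sum_(j < n) (F (j, false) + F (j, true)).
Proof.
have E (b : bool) : \sum_(d <- [seq (j, b) | j <- enum 'I_n]) F d = \sum_(j < n) F (j, b).
  by rewrite big_map big_enum.
by rewrite big_cat /= !E big_split.
Qed.

Lemma quarter_natE : 4^-1 = (4^-1 : R)%:C :> C.
Proof. by rewrite [RHS](fmorphV (real_complex R)) rmorph_nat. Qed.

Lemma re_wirt_laplacian m h : cbuc m.+2 h ->
  re_part (wirt_laplacian h) = quarter_laplacian coord_dirs (re_part h).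
Proof.
move=> bh; apply/funext => z; rewrite quarter_laplacianE big_coord_dirs.
rewrite /re_part Re_sum; apply: eq_bigr => j _.
rewrite (dz_dzb _ _ bh) quarter_natE ReM /= mul0r mulr0 addr0 ReD.
by rewrite -!/(re_part _ _) !re_cpartial mulrDr.
Qed.

Lemma im_wirt_laplacian m h : cbuc m.+2 h ->
  im_part (wirt_laplacian h) = quarter_laplacian coord_dirs (im_part h).
Proof.
move=> bh; apply/funext => z; rewrite quarter_laplacianE big_coord_dirs.
rewrite /im_part Im_sum; apply: eq_bigr => j _.
rewrite (dz_dzb _ _ bh) quarter_natE ImM /= mul0r addr0 ImD.
by rewrite -!/(im_part _ _) !im_cpartial mulrDr.
Qed.

Lemma cbuc_sum m (I : Type) (r : seq I) (F : I -> Cn -> C) :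
  (forall i, cbuc m (F i)) -> cbuc m (fun z => \sum_(i <- r) F i z).
Proof.
move=> bF; elim: r => [|i r IH].
  by under eq_fun do rewrite big_nil; exact: cbuc_cst.
by under eq_fun do rewrite big_cons; exact: cbucD.
Qed.

Lemma cbuc_wirt_laplacian m h : cbuc m.+2 h -> cbuc m (wirt_laplacian h).
Proof. by move=> bh; apply: cbuc_sum => j; do 2!apply: cbuc_wirt. Qed.

Lemma wirt_sum m c j (I : Type) (r : seq I) (F : I -> Cn -> C) :
  (forall i, cbuc m.+1 (F i)) ->
  wirt c j (fun z => \sum_(i <- r) F i z) = (fun z => \sum_(i <- r) wirt c j (F i) z).
Proof.
move=> bF; elim: r => [|i r IH].
  have -> : (fun z => \sum_(i <- [::]) F i z) = (fun=> 0).
    by apply/funext => z; rewrite big_nil.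
  apply/funext => z; rewrite big_nil /wirt.
  by rewrite (cpartial_cst (j, false)) (cpartial_cst (j, true)) mulr0 addr0 mulr0.
have -> : (fun z => \sum_(k <- i :: r) F k z) =
    (fun z => F i z + \sum_(k <- r) F k z).
  by apply/funext => z; rewrite big_cons.
rewrite (wirtD c j (bF i) (cbuc_sum r bF)) IH.
by apply/funext => z; rewrite big_cons.
Qed.

Lemma cplx_heat_sum m t (I : Type) (r : seq I) (F : I -> Cn -> C) z :
  (forall i, cbuc m (F i)) ->
  cplx_heat t (fun z => \sum_(i <- r) F i z) z = \sum_(i <- r) cplx_heat t (F i) z.
Proof.
move=> bF; elim: r => [|i r IH].
  rewrite big_nil.
  have -> : (fun z => \sum_(i <- [::]) F i z) = (fun z => 0 * (0 : C)).
    by apply/funext => x; rewrite big_nil mul0r.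
  by rewrite (cplx_heatZ t 0 (cbuc_cst 0 0)) mul0r.
have -> : (fun z => \sum_(k <- i :: r) F k z) =
    (fun z => F i z + \sum_(k <- r) F k z).
  by apply/funext => x; rewrite big_cons.
by rewrite (cplx_heatD t (bF i) (cbuc_sum r bF)) IH big_cons.
Qed.

(** The two sums of products of first derivatives are kept apart because they
    play different roles in the expansion. *)
Lemma wirt_laplacianM m h g z : cbuc m.+2 h -> cbuc m.+2 g ->
  wirt_laplacian (fun z => h z * g z) z =
  wirt_laplacian h z * g z + h z * wirt_laplacian g z +
  \sum_(j < n) dz j h z * dzb j g z + \sum_(j < n) dzb j h z * dz j g z.
Proof.
move=> bh bg; rewrite /wirt_laplacian mulr_suml mulr_sumr -!big_split /=.
apply: eq_bigr => j _.
have h1 := cbuc_wirt 'i%C j bh; have g1 := cbuc_wirt 'i%C j bg.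
rewrite (wirtM _ _ bh bg) (wirtD _ _ (cbucM h1 (cbucW bg)) (cbucM (cbucW bh) g1)).
rewrite (wirtM _ _ h1 (cbucW bg)) (wirtM _ _ (cbucW bh) g1).
by rewrite [X in _ + X = _]addrC addrACA [X in _ + X = _]addrC addrA.
Qed.

(** Real and imaginary parts are differentiated separately, as the real mean
    value theorem is applied to each of them. *)
Definition is_cderive (phi : R -> C) t c : Prop :=
  is_derive t 1 (fun s => complex.Re (phi s)) (complex.Re c) /\
  is_derive t 1 (fun s => complex.Im (phi s)) (complex.Im c).

Lemma is_cderiveD (phi psi : R -> C) t a b : is_cderive phi t a ->
  is_cderive psi t b -> is_cderive (fun s => phi s + psi s) t (a + b).
Proof.
move=> [h1 h2] [h3 h4]; split; rewrite ?ReD ?ImD.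
  by under eq_fun do rewrite ReD; exact: is_deriveD.
by under eq_fun do rewrite ImD; exact: is_deriveD.
Qed.

Lemma is_cderive_cst c t : is_cderive (fun=> c) t 0.
Proof. by split; exact: is_derive_cst. Qed.

Lemma is_cderive_real (F : R -> R) t (l : R) :
  is_derive t 1 F l -> is_cderive (fun s => (F s)%:C) t l%:C.
Proof. by split => //=; exact: is_derive_cst. Qed.

Lemma is_cderiveM (phi psi : R -> C) t a b : is_cderive phi t a ->
  is_cderive psi t b ->
  is_cderive (fun s => phi s * psi s) t (a * psi t + phi t * b).
Proof.
move=> [h1 h2] [h3 h4]; split.
  under eq_fun do rewrite ReM.
  by apply: is_derive_eq; rewrite /GRing.scale /= ReD !ReM; ring.
under eq_fun do rewrite ImM.
by apply: is_derive_eq; rewrite /GRing.scale /= ImD !ImM; ring.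
Qed.

Lemma is_cderive_sum t (I : Type) (r : seq I) (F : I -> R -> C) (l : I -> C) :
  (forall i, is_cderive (F i) t (l i)) ->
  is_cderive (fun s => \sum_(i <- r) F i s) t (\sum_(i <- r) l i).
Proof.
move=> dF; elim: r => [|i r IH].
  by under eq_fun do rewrite big_nil; rewrite big_nil; exact: is_cderive_cst.
by under eq_fun do rewrite big_cons; rewrite big_cons; exact: is_cderiveD.
Qed.

Lemma is_cderive_cplx_heat t h z : 0 < t -> cbuc 2 h ->
  is_cderive (fun s => cplx_heat s h z) t (cplx_heat t (wirt_laplacian h) z).
Proof.
move=> t0 bh; have [hR hI] := bh.
rewrite cplx_heat.unlock; split => /=.
  by rewrite (re_wirt_laplacian bh); exact: is_derive_heat_along.
by rewrite (im_wirt_laplacian bh); exact: is_derive_heat_along.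
Qed.

End ComplexLaplacian.

(** * Uniform asymptotics in time *)

Section UniformLittleO.
Context {R : realType} {n : nat}.
Local Notation C := R[i].
Local Notation Cn := 'rV[R[i]]_n.
Local Notation normc := (@Normc.normc R).
Implicit Types (z : Cn) (s t M e : R) (r q : R -> Cn -> C).

Definition unif_littleo (k : nat) r := forall e, 0 < e ->
  exists2 T : R, 0 < T & forall t, 0 < t < T -> forall z, normc (r t z) <= e * t ^+ k.

Lemma unif_littleo_ext k r q : (forall t z, 0 < t -> r t z = q t z) ->
  unif_littleo k r -> unif_littleo k q.
Proof.
move=> rq ro e /ro[T T0 H]; exists T => // t tT z.
by rewrite -rq ?H//; case/andP: tT.
Qed.

Lemma unif_littleoD k r q : unif_littleo k r -> unif_littleo k q ->
  unif_littleo k (fun t z => r t z + q t z).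
Proof.
move=> ro qo e e0; have e2 : 0 < e / 2 by rewrite divr_gt0.
have [T T0 H] := ro _ e2; have [T' T'0 H'] := qo _ e2.
exists (Num.min T T') => [|t /andP[t0]]; first by rewrite lt_min T0.
rewrite lt_min => /andP[tT tT'] z; rewrite [e]splitr mulrDl.
by apply: le_trans (le_normcD _ _) (lerD _ _); [apply: H|apply: H']; rewrite t0.
Qed.

Lemma unif_littleo0 k : unif_littleo k (fun _ _ => 0).
Proof.
move=> e e0; exists 1 => // t /andP[t0 _] z.
by rewrite Normc.normc0 mulr_ge0 ?exprn_ge0 ?ltW.
Qed.

Lemma unif_littleo_sum k (I : Type) (s : seq I) (F : I -> R -> Cn -> C) :
  (forall i, unif_littleo k (F i)) ->
  unif_littleo k (fun t z => \sum_(i <- s) F i t z).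
Proof.
move=> Fo; elim: s => [|i s IH].
  by apply: unif_littleo_ext (unif_littleo0 k) => t z _; rewrite big_nil.
by apply: unif_littleo_ext (unif_littleoD (Fo i) IH) => t z _; rewrite big_cons.
Qed.

Lemma unif_littleo_bounded k M (c : R -> Cn -> C) r :
  (forall t z, 0 < t -> normc (c t z) <= M) -> unif_littleo k r ->
  unif_littleo k (fun t z => c t z * r t z).
Proof.
move=> cM ro e e0; have M1 : 0 < `|M| + 1 by rewrite ltr_wpDl.
have [T T0 H] := ro _ (divr_gt0 e0 M1).
exists T => // t tT z; have t0 : 0 < t by case/andP: tT.
rewrite Normc.normcM (_ : e * t ^+ k = (`|M| + 1) * (e / (`|M| + 1) * t ^+ k)).
  apply: ler_pM; rewrite ?normc_ge0 ?H// (le_trans (cM _ _ t0))//.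
  by rewrite (le_trans (ler_norm _))// lerDl.
by field; rewrite gt_eqF.
Qed.

Lemma unif_littleo_exp k m (a : R) r : unif_littleo k r ->
  unif_littleo (m + k) (fun t z => (t ^+ m * a)%:C * r t z).
Proof.
move=> ro; have := @unif_littleo_bounded k `|a| (fun _ _ => a%:C) r.
move=> /(_ _ ro) aro e e0; have [|T T0 H] := aro _ _ e0.
  by move=> t z _; rewrite normc_real.
exists T => // t tT z; have t0 : 0 < t by case/andP: tT.
have := H t tT z; rewrite !Normc.normcM !normc_real normrM normrX gtr0_norm//.
by rewrite exprD mulrCA -mulrA ler_pM2l ?exprn_gt0.
Qed.

(** The value at 0 is only a limit: the increment on [s, t] is bounded first,
    and then [s] tends to 0. *)
Lemma mean_value_power (F F' : R -> R) (T K : R) k t :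
  (forall s, 0 < s < T -> is_derive s 1 F (F' s)) ->
  (forall s, 0 < s < T -> `|F' s| <= K * s ^+ k) ->
  (forall e, 0 < e -> exists2 r : R, 0 < r & forall s, 0 < s < r -> `|F s| <= e) ->
  0 < t < T -> `|F t| <= K * t ^+ k.+1.
Proof.
move=> dF F'K F0 tT; have /andP[t0 t1] := tT.
have K0 : 0 <= K.
  by rewrite -(pmulr_lge0 _ (exprn_gt0 k t0)); exact: le_trans (normr_ge0 _) (F'K t tT).
apply/ler_addgt0Pl => e e0; have [r r0 Fr] := F0 e e0.
pose s := Num.min (r / 2) (t / 2).
have s0 : 0 < s by rewrite lt_min !divr_gt0.
have sr : s < r by rewrite gt_min; apply/orP; left; lra.
have st : s < t by rewrite gt_min; apply/orP; right; lra.
have rg x : x \in `[s, t] -> 0 < x < T.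
  by rewrite in_itv /= => /andP[x1 x2]; rewrite (lt_le_trans s0 x1) (le_lt_trans x2 t1).
have [|||c cst E] := @MVT R F F' s t.
- by [].
- by move=> x /subset_itv_oo_cc/rg/dF.
- by apply: derivable_within_continuous => x /rg/dF dx; exact: ex_derive.
have cT := rg c (subset_itv_oo_cc cst).
move: cst; rewrite in_itv /= => /andP[sc ct].
have -> : F t = F s + (F t - F s) by rewrite addrC subrK.
apply: le_trans (ler_normD _ _) _; apply: lerD; first by apply: Fr; rewrite s0.
rewrite E normrM exprSr mulrA; apply: ler_pM => //.
  apply: le_trans (F'K _ cT) _; rewrite ler_wpM2l// lerXn2r ?nnegrE ?ltW//.
  by case/andP: cT.
by rewrite gtr0_norm ?subr_gt0// lerBlDr lerDl ltW.
Qed.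

Lemma unif_littleo_integrate k r q :
  (forall t z, 0 < t -> is_cderive (fun s => r s z) t (q t z)) ->
  unif_littleo k q -> unif_littleo 0 r -> unif_littleo k.+1 r.
Proof.
move=> dr qo r0 e e0; have e2 : 0 < e / 2 by rewrite divr_gt0.
have [T T0 H] := qo _ e2; exists T => // t tT z.
have rlim e' : 0 < e' -> exists2 d : R, 0 < d &
    forall s, 0 < s < d -> normc (r s z) <= e'.
  move=> /r0[d d0 Hd]; exists d => // s sd.
  by have := Hd s sd z; rewrite expr0 mulr1.
rewrite [e]splitr mulrDl; apply: le_trans (normc_le_abs _) (lerD _ _).
- apply: (@mean_value_power (fun s => complex.Re (r s z))
    (fun s => complex.Re (q s z)) T) => //.
  + by move=> s /andP[s0 _]; have [] := dr s z s0.
  + by move=> s sT; exact: le_trans (normc_ge_abs_Re _) (H s sT z).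
  + move=> e' /rlim[d d0 Hd]; exists d => // s sd.
    exact: le_trans (normc_ge_abs_Re _) (Hd s sd).
- apply: (@mean_value_power (fun s => complex.Im (r s z))
    (fun s => complex.Im (q s z)) T) => //.
  + by move=> s /andP[s0 _]; have [] := dr s z s0.
  + by move=> s sT; exact: le_trans (normc_ge_abs_Im _) (H s sT z).
  + move=> e' /rlim[d d0 Hd]; exists d => // s sd.
    exact: le_trans (normc_ge_abs_Im _) (Hd s sd).
Qed.

End UniformLittleO.

(** * Sums over words of derivatives *)

Section WordSum.
Context {R : realType} {n : nat}.
Local Notation C := R[i].
Local Notation Cn := 'rV[R[i]]_n.
Local Notation normc := (@Normc.normc R).
Local Notation dz := (wirt (- 'i%C)).
Local Notation dzb := (wirt 'i%C).
Implicit Types (f g h : Cn -> C) (z : Cn) (s t M e : R) (a b c : C).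
Implicit Types (X Y : (Cn -> C) -> (Cn -> C) -> C).

(** The sum of [X (D_w f) (D'_w g)] over all words [w] of length [i] in the
    letters [0..n-1]. A recursion in the length replaces the bookkeeping of
    multi-indices in every differentiation. *)
Fixpoint word_sum c c' X (i : nat) f g : C :=
  if i is i'.+1 then \sum_(j < n) word_sum c c' X i' (wirt c j f) (wirt c' j g)
  else X f g.

Lemma word_sum_is_cderive c c' m i (X : R -> (Cn -> C) -> (Cn -> C) -> C) X' t f g :
  (forall u v, cbuc m u -> cbuc m v -> is_cderive (fun s => X s u v) t (X' u v)) ->
  cbuc (i + m) f -> cbuc (i + m) g ->
  is_cderive (fun s => word_sum c c' (X s) i f g) t (word_sum c c' X' i f g).
Proof.
move=> dX; elim: i f g => [|i IH] f g bf bg /=; first exact: dX.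
by apply: is_cderive_sum => j; apply: IH; exact: cbuc_wirt.
Qed.

Lemma word_sum_littleo c c' k i (X : R -> Cn -> (Cn -> C) -> (Cn -> C) -> C) f g :
  (forall u v, cbuc 0 u -> cbuc 0 v -> unif_littleo k (fun t z => X t z u v)) ->
  cbuc i f -> cbuc i g ->
  unif_littleo k (fun t z => word_sum c c' (X t z) i f g).
Proof.
move=> oX; elim: i f g => [|i IH] f g bf bg /=; first exact: oX.
by apply: unif_littleo_sum => j; apply: IH; exact: cbuc_wirt.
Qed.

Lemma word_sum_bounded c c' i (X : Cn -> (Cn -> C) -> (Cn -> C) -> C) f g :
  (forall u v, cbuc 0 u -> cbuc 0 v -> exists M, forall z, normc (X z u v) <= M) ->
  cbuc i f -> cbuc i g -> exists M, forall z, normc (word_sum c c' (X z) i f g) <= M.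
Proof.
move=> bX; elim: i f g => [|i IH] f g bf bg /=; first exact: bX.
elim: (index_enum _) => [|j r [M IHr]].
  by exists 0 => z; rewrite big_nil Normc.normc0.
have [N HN] := IH _ _ (cbuc_wirt c j bf) (cbuc_wirt c' j bg).
exists (N + M) => z; rewrite big_cons.
exact: le_trans (le_normcD _ _) (lerD (HN z) (IHr z)).
Qed.

Lemma word_sumD c c' i X Y f g :
  word_sum c c' (fun u v => X u v + Y u v) i f g =
  word_sum c c' X i f g + word_sum c c' Y i f g.
Proof.
elim: i f g => [|i IH] f g //=.
by rewrite -big_split; apply: eq_bigr => j _; exact: IH.
Qed.

Lemma word_sumB c c' i X Y f g :
  word_sum c c' (fun u v => X u v - Y u v) i f g =
  word_sum c c' X i f g - word_sum c c' Y i f g.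
Proof.
elim: i f g => [|i IH] f g //=.
by rewrite -sumrB; apply: eq_bigr => j _; exact: IH.
Qed.

Lemma word_sum_sum c c' i (X : 'I_n -> (Cn -> C) -> (Cn -> C) -> C) f g :
  word_sum c c' (fun u v => \sum_(l < n) X l u v) i f g =
  \sum_(l < n) word_sum c c' (X l) i f g.
Proof.
elim: i f g => [|i IH] f g //=.
by rewrite exchange_big; apply: eq_bigr => j _; exact: IH.
Qed.

Lemma wirt_laplacian_wirt m c j h : cbuc m.+3 h ->
  wirt_laplacian (wirt c j h) = wirt c j (wirt_laplacian h).
Proof.
move=> bh; rewrite /wirt_laplacian.
rewrite (@wirt_sum _ _ m c j _ _ (fun l => dz l (dzb l h))); last first.
  by move=> l; do 2!apply: cbuc_wirt.
apply/funext => z; apply: eq_bigr => l _.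
by rewrite (wirtC _ _ _ _ bh) (wirtC _ _ _ _ (cbuc_wirt 'i%C l bh)).
Qed.

Lemma word_sum_laplacian_l c c' i X f g : cbuc (i + 2) f ->
  word_sum c c' (fun u v => X (wirt_laplacian u) v) i f g =
  word_sum c c' X i (wirt_laplacian f) g.
Proof.
elim: i f g => [|i IH] f g //= bf; apply: eq_bigr => j _.
rewrite IH; last exact: cbuc_wirt.
by rewrite (@wirt_laplacian_wirt 0)//; apply: cbuc_le bf; rewrite addn2.
Qed.

Lemma word_sum_laplacian_r c c' i X f g : cbuc (i + 2) g ->
  word_sum c c' (fun u v => X u (wirt_laplacian v)) i f g =
  word_sum c c' X i f (wirt_laplacian g).
Proof.
elim: i f g => [|i IH] f g //= bg; apply: eq_bigr => j _.
rewrite IH; last exact: cbuc_wirt.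
by rewrite (@wirt_laplacian_wirt 0)//; apply: cbuc_le bg; rewrite addn2.
Qed.

Lemma word_sum_wirt c c' a b l i X f g : cbuc i.+1 f -> cbuc i.+1 g ->
  word_sum c c' (fun u v => X (wirt a l u) (wirt b l v)) i f g =
  word_sum c c' X i (wirt a l f) (wirt b l g).
Proof.
elim: i f g => [|i IH] f g //= bf bg; apply: eq_bigr => j _.
rewrite IH; [|exact: cbuc_wirt|exact: cbuc_wirt].
by rewrite (wirtC a c l j bf) (wirtC b c' l j bg).
Qed.

Lemma word_sumSr c c' i X f g : cbuc i.+1 f -> cbuc i.+1 g ->
  word_sum c c' (fun u v => \sum_(l < n) X (wirt c l u) (wirt c' l v)) i f g =
  word_sum c c' X i.+1 f g.
Proof.
move=> bf bg; rewrite word_sum_sum; apply: eq_bigr => l _.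
exact: word_sum_wirt.
Qed.

(** The two sides of the expansion are sums over words of this bilinear
    expression and of the next one. *)
Definition heat_of_product t z f g : C := cplx_heat t (fun w => f w * g w) z.

Definition product_of_heats t z f g : C := cplx_heat t f z * cplx_heat t g z.

(** The time derivative is the heat flow of the Laplacian of a product; its two
    mixed sums are absent for [product_of_heats]. *)
Lemma heat_of_product_is_cderive t z f g : 0 < t -> cbuc 2 f -> cbuc 2 g ->
  is_cderive (fun s => heat_of_product s z f g) t
    (heat_of_product t z (wirt_laplacian f) g + heat_of_product t z f (wirt_laplacian g) +
     \sum_(j < n) heat_of_product t z (dz j f) (dzb j g) +
     \sum_(j < n) heat_of_product t z (dzb j f) (dz j g)).
Proof.
move=> t0 bf bg; have := is_cderive_cplx_heat z t0 (cbucM bf bg).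
have Lf := cbuc_wirt_laplacian bf; have Lg := cbuc_wirt_laplacian bg.
have f0 := cbuc0 bf; have g0 := cbuc0 bg.
have b1 j : cbuc 0 (fun z => dz j f z * dzb j g z).
  by apply: cbucM; apply: cbuc_wirt; exact: cbucW.
have b2 j : cbuc 0 (fun z => dzb j f z * dz j g z).
  by apply: cbucM; apply: cbuc_wirt; exact: cbucW.
have -> : wirt_laplacian (fun z => f z * g z) = (fun z =>
    wirt_laplacian f z * g z + f z * wirt_laplacian g z +
    \sum_(j < n) dz j f z * dzb j g z + \sum_(j < n) dzb j f z * dz j g z).
  by apply/funext => x; exact: wirt_laplacianM bf bg.
have c1 := cbucM Lf g0; have c2 := cbucM f0 Lg.
have c3 := cbuc_sum (index_enum _) b1; have c4 := cbuc_sum (index_enum _) b2.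
rewrite (cplx_heatD t (cbucD (cbucD c1 c2) c3) c4) (cplx_heatD t (cbucD c1 c2) c3).
rewrite (cplx_heatD t c1 c2).
by rewrite (cplx_heat_sum _ _ _ b1) (cplx_heat_sum _ _ _ b2).
Qed.

Lemma product_of_heats_is_cderive t z f g : 0 < t -> cbuc 2 f -> cbuc 2 g ->
  is_cderive (fun s => product_of_heats s z f g) t
    (product_of_heats t z (wirt_laplacian f) g + product_of_heats t z f (wirt_laplacian g)).
Proof.
by move=> t0 bf bg; apply: is_cderiveM; exact: is_cderive_cplx_heat.
Qed.

Definition F_word i t z f g := word_sum (- 'i%C) 'i%C (heat_of_product t z) i f g.

Definition G_word i t z f g := word_sum 'i%C (- 'i%C) (product_of_heats t z) i f g.

(** The first mixed sum lengthens the words by one letter; in the second one the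
    conjugate derivatives fall on [f] and [g] themselves, since all letters
    commute. *)
Lemma F_word_is_cderive i t z f g : 0 < t -> cbuc (i + 2) f -> cbuc (i + 2) g ->
  is_cderive (fun s => F_word i s z f g) t
    (F_word i t z (wirt_laplacian f) g + F_word i t z f (wirt_laplacian g) +
     F_word i.+1 t z f g + \sum_(j < n) F_word i t z (dzb j f) (dz j g)).
Proof.
move=> t0 bf bg.
have := word_sum_is_cderive (- 'i%C) 'i%C
  (fun u v bu bv => heat_of_product_is_cderive z t0 bu bv) bf bg.
rewrite !word_sumD word_sum_laplacian_l// word_sum_laplacian_r//.
have bf1 : cbuc i.+1 f by apply: cbuc_le bf; rewrite addn2.
have bg1 : cbuc i.+1 g by apply: cbuc_le bg; rewrite addn2.
rewrite word_sumSr//.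
rewrite (@word_sum_sum _ _ _ (fun l u v => heat_of_product t z (dzb l u) (dz l v))).
by under [X in _ + X]eq_bigr do rewrite word_sum_wirt//.
Qed.

Lemma G_word_is_cderive i t z f g : 0 < t -> cbuc (i + 2) f -> cbuc (i + 2) g ->
  is_cderive (fun s => G_word i s z f g) t
    (G_word i t z (wirt_laplacian f) g + G_word i t z f (wirt_laplacian g)).
Proof.
move=> t0 bf bg.
have := word_sum_is_cderive 'i%C (- 'i%C)
  (fun u v bu bv => product_of_heats_is_cderive z t0 bu bv) bf bg.
by rewrite !word_sumD word_sum_laplacian_l// word_sum_laplacian_r.
Qed.

End WordSum.

(** * The expansion to all orders *)

Section MainExpansion.
Context {R : realType} {n : nat}.
Local Notation C := R[i].
Local Notation Cn := 'rV[R[i]]_n.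
Local Notation normc := (@Normc.normc R).
Local Notation dz := (wirt (- 'i%C)).
Local Notation dzb := (wirt 'i%C).
Implicit Types (f g h : Cn -> C) (z : Cn) (s t M e : R).

Lemma unif_littleo_le k k' (r : R -> Cn -> C) : (k <= k')%N ->
  unif_littleo k' r -> unif_littleo k r.
Proof.
move=> kk' ro e e0; have [T T0 H] := ro e e0.
exists (Num.min T 1) => [|t /andP[t0]]; first by rewrite lt_min T0 ltr01.
rewrite lt_min => /andP[tT t1] z; apply: le_trans (H _ _ _) _; first by rewrite t0.
by rewrite ler_pM2l// ler_wiXn2l// ltW.
Qed.

Lemma unif_littleo_id_exp m (a : R) :
  unif_littleo 0 (fun t (_ : Cn) => (t ^+ m.+1 * a)%:C).
Proof.
move=> e e0; have a1 : 0 < `|a| + 1 by rewrite ltr_wpDl.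
exists (Num.min 1 (e / (`|a| + 1))) => [|t /andP[t0]].
  by rewrite lt_min ltr01 divr_gt0.
rewrite lt_min => /andP[t1 te] z; rewrite expr0 mulr1 normc_real normrM normrX gtr0_norm//.
rewrite ltr_pdivlMr// in te; apply: le_trans (ltW te).
have t0' := ltW t0; apply: ler_pM; rewrite ?exprn_ge0//; last by rewrite lerDl.
by rewrite exprS ler_piMr// exprn_ile1// ltW.
Qed.

Lemma heat_of_product_cvg f g : cbuc 0 f -> cbuc 0 g ->
  unif_littleo 0 (fun t z => heat_of_product t z f g - f z * g z).
Proof.
move=> bf bg e e0; have [T T0 H] := cplx_heat_cvg0 (cbucM bf bg) e0.
by exists T => // t tT z; rewrite expr0 mulr1; exact: H.
Qed.

Lemma cplx_heat_littleo h : cbuc 0 h -> unif_littleo 0 (fun t z => cplx_heat t h z - h z).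
Proof.
move=> bh e e0; have [T T0 H] := cplx_heat_cvg0 bh e0.
by exists T => // t tT z; rewrite expr0 mulr1; exact: H.
Qed.

Lemma product_of_heats_cvg f g : cbuc 0 f -> cbuc 0 g ->
  unif_littleo 0 (fun t z => product_of_heats t z f g - f z * g z).
Proof.
move=> bf bg; have [M _ gM] := cplx_heat_bounded bg; have [N _ fN] := cbuc_bounded bf.
have o1 := unif_littleo_bounded (fun t z _ => gM t z) (cplx_heat_littleo bf).
have o2 := unif_littleo_bounded (c := fun _ z => f z) (fun t z _ => fN z) (cplx_heat_littleo bg).
apply: unif_littleo_ext (unif_littleoD o1 o2) => t z _ /=.
by rewrite /product_of_heats; ring.
Qed.

Definition exp_coef (a t : R) i : C := ((a * t) ^+ i / (i`!)%:R)%:C.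

Lemma exp_coef_is_cderive (a t : R) i :
  is_cderive (fun s => exp_coef a s i.+1) t (a%:C * exp_coef a t i).
Proof.
rewrite /exp_coef -(rmorphM (real_complex R)); apply: is_cderive_real.
have h : is_derive t 1 ( *%R a) a.
  by apply: is_derive_eq; rewrite /GRing.scale /=; ring.
have i0 : (i`!)%:R != 0 :> R by rewrite pnatr_eq0 -lt0n fact_gt0.
have i1 : (i.+1)%:R != 0 :> R by rewrite pnatr_eq0.
have -> : (fun s => (a * s) ^+ i.+1 / (i.+1)`!%:R) =
    ((i.+1)`!%:R^-1 : R) \*: (fun s => (a * s) ^+ i.+1).
  by apply/funext => s; rewrite /= mulrC.
have hX : is_derive t 1 (fun s => (a * s) ^+ i.+1) ((i.+1)%:R * (a * t) ^+ i * a).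
  apply: (@is_derive1_comp _ (fun y : R => y ^+ i.+1) ( *%R a)).
  apply: DeriveDef; first exact: exprn_derivable.
  by rewrite -derive1E exp_derive1.
apply: is_derive_eq; rewrite /GRing.scale /= factS natrM.
by field; rewrite i0 ?nat1r ?natr1 i1.
Qed.

(** Up to the factor [a], the derivative of each coefficient is the previous
    coefficient. *)
Lemma exp_sum_is_cderive (a t : R) k (W : nat -> R -> C) (W' : nat -> C) :
  (forall i, (i <= k)%N -> is_cderive (W i) t (W' i)) ->
  is_cderive (fun s => \sum_(i < k.+1) exp_coef a s i * W i s) t
    (\sum_(i < k.+1) exp_coef a t i * W' i +
     a%:C * \sum_(i < k) exp_coef a t i * W i.+1 t).
Proof.
elim: k => [|k IH] dW.
  have -> : (fun s => \sum_(i < 1) exp_coef a s i * W i s) =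
      (fun s => exp_coef a t 0 * W 0%N s).
    by apply/funext => s; rewrite big_ord1 /exp_coef !expr0.
  rewrite big_ord0 mulr0 addr0 big_ord1.
  have := is_cderiveM (is_cderive_cst (exp_coef a t 0) t) (dW 0%N isT).
  by rewrite mul0r add0r.
have h := IH (fun i ik => dW i (leqW ik)).
have h' := is_cderiveM (exp_coef_is_cderive a t k) (dW k.+1 (leqnn _)).
have -> : (fun s => \sum_(i < k.+2) exp_coef a s i * W i s) =
    (fun s => \sum_(i < k.+1) exp_coef a s i * W i s + exp_coef a s k.+1 * W k.+1 s).
  by apply/funext => s; rewrite (big_ord_recr k.+1).
rewrite (big_ord_recr k.+1) [X in a%:C * X](big_ord_recr k) /= mulrDr addrACA mulrA.
rewrite [exp_coef a t k.+1 * W' k.+1 + _]addrC; exact: is_cderiveD h h'.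
Qed.

Lemma F_sum_algebra (A B S T P : C) :
  A + B + (S + T) + P + -1 * S = A + B + P + T.
Proof. by ring. Qed.

Lemma top_defect_algebra (c A B A' B' : C) :
  c * (A - A') + -1 * (B - B') = c * A - B - (c * A' - B').
Proof. by ring. Qed.

Lemma defect_algebra (A B S A' B' S' c e F G : C) :
  A + B + S + - c * e * F + -1 * (A' + B' + S' - e * G) =
  A - A' + (B - B') + (S - S') - e * (c * F - G).
Proof. by ring. Qed.

Lemma defectS_algebra (A B c e F G : C) :
  A + c * e * F - (B + e * G) = A - B + e * (c * F - G).
Proof. by ring. Qed.

Lemma defect_integrand_algebra (A e Z Z0 : C) :
  A - e * Z + e * Z0 = A + - e * (Z - Z0).
Proof. by ring. Qed.

Lemma defect_split_algebra (A e Z Z0 : C) : A + e * Z0 + e * (Z - Z0) = A + e * Z.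
Proof. by ring. Qed.

Definition F_sum k t z f g := \sum_(i < k.+1) exp_coef (-1) t i * F_word i t z f g.

Definition G_sum k t z f g := \sum_(i < k.+1) exp_coef 1 t i * G_word i t z f g.

Definition defect k t z f g := F_sum k t z f g - G_sum k t z f g.

(** For [a = -1] the derivatives of the coefficients cancel all terms
    [F_word i.+1] but the last. *)
Lemma F_sum_is_cderive k t z f g : 0 < t -> cbuc (k + 2) f -> cbuc (k + 2) g ->
  is_cderive (fun s => F_sum k s z f g) t
    (F_sum k t z (wirt_laplacian f) g + F_sum k t z f (wirt_laplacian g) +
     \sum_(j < n) F_sum k t z (dzb j f) (dz j g) +
     exp_coef (-1) t k * F_word k.+1 t z f g).
Proof.
move=> t0 bf bg.
have dF i : (i <= k)%N -> is_cderive (fun s => F_word i s z f g) t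
    (F_word i t z (wirt_laplacian f) g + F_word i t z f (wirt_laplacian g) +
     F_word i.+1 t z f g + \sum_(j < n) F_word i t z (dzb j f) (dz j g)).
  move=> ik; have ik2 : (i + 2 <= k + 2)%N by rewrite leq_add2r.
  exact: F_word_is_cderive t0 (cbuc_le ik2 bf) (cbuc_le ik2 bg).
have := exp_sum_is_cderive (-1) dF; rewrite -/(F_sum k _ z f g).
suff -> : \sum_(i < k.+1) exp_coef (-1) t i *
     (F_word i t z (wirt_laplacian f) g + F_word i t z f (wirt_laplacian g) +
      F_word i.+1 t z f g + \sum_(j < n) F_word i t z (dzb j f) (dz j g)) +
   (-1)%:C * \sum_(i < k) exp_coef (-1) t i * F_word i.+1 t z f g =
   F_sum k t z (wirt_laplacian f) g + F_sum k t z f (wirt_laplacian g) +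
     \sum_(j < n) F_sum k t z (dzb j f) (dz j g) +
     exp_coef (-1) t k * F_word k.+1 t z f g by [].
have -> : \sum_(j < n) F_sum k t z (dzb j f) (dz j g) =
    \sum_(i < k.+1) exp_coef (-1) t i *
      \sum_(j < n) F_word i t z (dzb j f) (dz j g).
  by rewrite exchange_big; apply: eq_bigr => i _; rewrite mulr_sumr.
under eq_bigr do rewrite 3!mulrDr.
rewrite 3!big_split /= -/(F_sum k t z (wirt_laplacian f) g) -/(F_sum k t z f (wirt_laplacian g)).
rewrite [\sum_(i < k.+1) exp_coef (-1) t i * F_word i.+1 t z f g]big_ord_recr /=.
have -> : (-1)%:C = -1 :> C by rewrite (rmorphN1 (real_complex R)).
exact: F_sum_algebra.
Qed.

(** For [a = 1] the derivatives of the coefficients supply the sum over [j],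
    up to its term of top order: a word extended by one letter is a word in the
    derivatives of [f] and [g]. *)
Lemma G_sum_is_cderive k t z f g : 0 < t -> cbuc (k + 2) f -> cbuc (k + 2) g ->
  is_cderive (fun s => G_sum k s z f g) t
    (G_sum k t z (wirt_laplacian f) g + G_sum k t z f (wirt_laplacian g) +
     \sum_(j < n) G_sum k t z (dzb j f) (dz j g) -
     exp_coef 1 t k * G_word k.+1 t z f g).
Proof.
move=> t0 bf bg.
have dG i : (i <= k)%N -> is_cderive (fun s => G_word i s z f g) t
    (G_word i t z (wirt_laplacian f) g + G_word i t z f (wirt_laplacian g)).
  move=> ik; have ik2 : (i + 2 <= k + 2)%N by rewrite leq_add2r.
  exact: G_word_is_cderive t0 (cbuc_le ik2 bf) (cbuc_le ik2 bg).
have := exp_sum_is_cderive 1 dG; rewrite -/(G_sum k _ z f g).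
suff -> : \sum_(i < k.+1) exp_coef 1 t i *
     (G_word i t z (wirt_laplacian f) g + G_word i t z f (wirt_laplacian g)) +
   1%:C * \sum_(i < k) exp_coef 1 t i * G_word i.+1 t z f g =
   G_sum k t z (wirt_laplacian f) g + G_sum k t z f (wirt_laplacian g) +
     \sum_(j < n) G_sum k t z (dzb j f) (dz j g) -
     exp_coef 1 t k * G_word k.+1 t z f g by [].
have -> : \sum_(j < n) G_sum k t z (dzb j f) (dz j g) =
    \sum_(i < k.+1) exp_coef 1 t i * G_word i.+1 t z f g.
  by rewrite exchange_big; apply: eq_bigr => i _; rewrite -mulr_sumr.
under eq_bigr do rewrite mulrDr.
rewrite big_split /= -/(G_sum k t z (wirt_laplacian f) g) -/(G_sum k t z f (wirt_laplacian g)).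
rewrite [\sum_(i < k.+1) exp_coef 1 t i * G_word i.+1 t z f g]big_ord_recr /=.
have -> : 1%:C = 1 :> C by rewrite (rmorph1 (real_complex R)).
by rewrite mul1r addrA addrK.
Qed.

(** The term of order [k] of the defect, without the factor t^k / k!. *)
Definition top_defect k t z f g :=
  ((-1) ^+ k)%:C * F_word k t z f g - G_word k t z f g.

(** The limit of [top_defect] as [t] tends to 0. *)
Definition top_defect0 k z f g :=
  ((-1) ^+ k)%:C * word_sum (- 'i%C) 'i%C (fun u v => u z * v z) k f g -
  word_sum 'i%C (- 'i%C) (fun u v => u z * v z) k f g.

Lemma top_defect_cvg k f g : cbuc k f -> cbuc k g ->
  unif_littleo 0 (fun t z => top_defect k t z f g - top_defect0 k z f g).
Proof.
move=> bf bg.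
have o1 := word_sum_littleo (- 'i%C) 'i%C heat_of_product_cvg bf bg.
have o2 := word_sum_littleo 'i%C (- 'i%C) product_of_heats_cvg bf bg.
have o1' := unif_littleo_bounded (c := fun _ _ => ((-1) ^+ k)%:C)
  (fun t z _ => lexx _) o1.
have o2' := unif_littleo_bounded (c := fun _ _ => (- 1 : C)) (fun t z _ => lexx _) o2.
apply: unif_littleo_ext (unif_littleoD o1' o2') => t z _ /=.
by rewrite !word_sumB; exact: top_defect_algebra.
Qed.

Lemma top_defect0_bounded k f g : cbuc k f -> cbuc k g ->
  exists M, forall z, normc (top_defect0 k z f g) <= M.
Proof.
move=> bf bg.
have bX u v : cbuc 0 u -> cbuc 0 v -> exists M, forall z, normc (u z * v z) <= M.
  move=> bu bv; have [M _ HM] := cbuc_bounded (cbucM bu bv); by exists M.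
have [M1 H1] := word_sum_bounded (- 'i%C) 'i%C bX bf bg.
have [M2 H2] := word_sum_bounded 'i%C (- 'i%C) bX bf bg.
exists (M1 + M2) => z; apply: le_trans (le_normcD _ _) (lerD _ _).
  by rewrite Normc.normcM normc_real normrX normrN1 expr1n mul1r.
by rewrite normcN.
Qed.

Lemma defect_is_cderive k t z f g : 0 < t -> cbuc (k + 2) f -> cbuc (k + 2) g ->
  is_cderive (fun s => defect k s z f g) t
    (defect k t z (wirt_laplacian f) g + defect k t z f (wirt_laplacian g) +
     \sum_(j < n) defect k t z (dzb j f) (dz j g) -
     exp_coef 1 t k * top_defect k.+1 t z f g).
Proof.
move=> t0 bf bg.
have dF := F_sum_is_cderive z t0 bf bg; have dG := G_sum_is_cderive z t0 bf bg.
have := is_cderiveD dF (is_cderiveM (is_cderive_cst (-1) t) dG).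
rewrite mul0r add0r.
have -> : (fun s => F_sum k s z f g + -1 * G_sum k s z f g) =
    (fun s => defect k s z f g) by apply/funext => s; rewrite mulN1r.
have E : exp_coef (-1) t k = - ((-1) ^+ k.+1)%:C * exp_coef 1 t k.
  rewrite /exp_coef mul1r -(rmorphN (real_complex R)) -(rmorphM (real_complex R)).
  by congr (_%:C); rewrite exprMn exprS mulN1r opprK mulrA.
by rewrite E /top_defect /defect sumrB defect_algebra.
Qed.

Lemma defectS k t z f g : defect k.+1 t z f g =
  defect k t z f g + exp_coef 1 t k.+1 * top_defect k.+1 t z f g.
Proof.
rewrite /defect /F_sum /G_sum !(big_ord_recr k.+1) /=.
have E : exp_coef (-1) t k.+1 = ((-1) ^+ k.+1)%:C * exp_coef 1 t k.+1.
  rewrite /exp_coef mul1r -(rmorphM (real_complex R)).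
  by congr (_%:C); rewrite exprMn mulrA.
rewrite E /top_defect; exact: defectS_algebra.
Qed.

Lemma exp_coef1 t i : exp_coef 1 t i = (t ^+ i * (i`!)%:R^-1)%:C.
Proof. by rewrite /exp_coef mul1r. Qed.

(** The time derivative of the defect of order [k] is a sum of defects of order
    [k] of derivatives of [f] and [g], up to a multiple of [top_defect k.+1].
    Integrating in time gains the missing power of [t]. *)
Theorem defect_littleo k f g : cbuc (2 * k) f -> cbuc (2 * k) g ->
  unif_littleo k (fun t z => defect k t z f g).
Proof.
elim: k f g => [|k IH] f g bf bg.
  have o1 := heat_of_product_cvg bf bg.
  have o2 := unif_littleo_bounded (c := fun _ _ => (-1 : C)) (fun t z _ => lexx _)
    (product_of_heats_cvg bf bg).
  apply: unif_littleo_ext (unif_littleoD o1 o2) => t z _ /=.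
  rewrite /defect /F_sum /G_sum !big_ord1 /exp_coef !expr0 fact0 divr1.
  rewrite (rmorph1 (real_complex R)) !mul1r /F_word /G_word /=; ring.
have le2 : (2 * k <= 2 * k.+1)%N by rewrite leq_pmul2l.
have bf2 : cbuc (2 * k).+2 f by move: bf; rewrite mulnS.
have bg2 : cbuc (2 * k).+2 g by move: bg; rewrite mulnS.
have bfk2 : cbuc (k + 2) f by apply: cbuc_le bf2; lia.
have bgk2 : cbuc (k + 2) g by apply: cbuc_le bg2; lia.
have bfk1 : cbuc k.+1 f by apply: cbuc_le bf2; lia.
have bgk1 : cbuc k.+1 g by apply: cbuc_le bg2; lia.
have oZ := top_defect_cvg bfk1 bgk1.
have [M ZM] := top_defect0_bounded bfk1 bgk1.
pose a : R := (k.+1)`!%:R^-1.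
(* With the limit of the top-order term added, the time derivative becomes
   o(t^k). *)
pose r t z := defect k t z f g + (t ^+ k.+1 * a)%:C * top_defect0 k.+1 z f g.
have or : unif_littleo k.+1 r.
  pose q t z := defect k t z (wirt_laplacian f) g + defect k t z f (wirt_laplacian g) +
    \sum_(j < n) defect k t z (dzb j f) (dz j g) +
    (t ^+ k * - (k`!)%:R^-1)%:C *
      (top_defect k.+1 t z f g - top_defect0 k.+1 z f g).
  apply: (@unif_littleo_integrate _ _ _ r q).
  - move=> t z t0.
    have dd := defect_is_cderive z t0 bfk2 bgk2.
    have dc := is_cderiveM (exp_coef_is_cderive 1 t k)
      (is_cderive_cst (top_defect0 k.+1 z f g) t).
    have := is_cderiveD dd dc; rewrite mulr0 addr0 exp_coef1.
    have -> : (fun s => defect k s z f g + exp_coef 1 s k.+1 * top_defect0 k.+1 z f g) =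
        (fun s => r s z) by apply/funext => s; rewrite exp_coef1.
    rewrite (rmorph1 (real_complex R)) mul1r /q.
    have -> : (t ^+ k * - (k`!)%:R^-1)%:C = - (t ^+ k * (k`!)%:R^-1)%:C :> C.
      by rewrite mulrN (rmorphN (real_complex R)).
    by rewrite defect_integrand_algebra.
  - have b1 := cbuc_wirt_laplacian bf2; have b2 := cbuc_wirt_laplacian bg2.
    apply: unif_littleoD; last by rewrite -[k in unif_littleo k]addn0; exact: unif_littleo_exp.
    apply: unif_littleoD; last first.
      apply: (@unif_littleo_sum _ _ _ _ _ (fun j t z => defect k t z (dzb j f) (dz j g))) => j.
      by apply: IH; apply: cbucW; exact: cbuc_wirt.
    by apply: unif_littleoD; apply: IH => //; do 2!apply: cbucW.
  - apply: unif_littleoD.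
      by apply: (unif_littleo_le (leq0n k)); apply: IH; do 2!apply: cbucW.
    have := unif_littleo_bounded (c := fun _ z => top_defect0 k.+1 z f g)
      (fun t z _ => ZM z) (unif_littleo_id_exp k a).
    by apply: unif_littleo_ext => t z _; rewrite mulrC.
have oZ' := unif_littleo_exp k.+1 a oZ; rewrite addn0 in oZ'.
apply: unif_littleo_ext (unif_littleoD or oZ') => t z _.
rewrite defectS exp_coef1 /r -/a; exact: defect_split_algebra.
Qed.

End MainExpansion.

(** * From words to multi-indices *)

Section MultiIndexSums.
Context {R : realType} {n : nat}.
Local Notation C := R[i].
Local Notation Cn := 'rV[R[i]]_n.
Implicit Types (f g h : Cn -> C) (z : Cn) (a b : 'I_n -> nat) (c : C).
Implicit Types (X : (Cn -> C) -> (Cn -> C) -> C) (s : seq 'I_n).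

Definition wirt_along s c a h : Cn -> C := foldr (fun j => iter (a j) (wirt c j)) h s.

Lemma cbuc_iter_wirt m k c j h : cbuc (k + m) h -> cbuc m (iter k (wirt c j) h).
Proof.
elim: k m h => [|k IH] m h bh //=.
by apply: cbuc_wirt; apply: IH; rewrite addnS.
Qed.

Lemma cbuc_wirt_along m s c a h :
  cbuc (\sum_(j <- s) a j + m) h -> cbuc m (wirt_along s c a h).
Proof.
elim: s m => [|j s IH] m; first by rewrite big_nil.
rewrite big_cons => bh; apply: cbuc_iter_wirt; apply: IH.
by rewrite addnA [(_ + a j)%N]addnC.
Qed.

Lemma wirt_iterC c j l k h : cbuc k.+1 h ->
  wirt c l (iter k (wirt c j) h) = iter k (wirt c j) (wirt c l h).
Proof.
elim: k => [|k IH] //= bh; rewrite -(IH (cbucW bh)).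
by apply: (@wirtC _ _ 0); apply: cbuc_iter_wirt; rewrite addn2.
Qed.

Lemma wirt_wirt_along s c a l h : cbuc (\sum_(j <- s) a j).+1 h ->
  wirt c l (wirt_along s c a h) = wirt_along s c a (wirt c l h).
Proof.
elim: s => [|j s IH] //=; rewrite big_cons => bh.
rewrite wirt_iterC; last by apply: cbuc_wirt_along; rewrite addnS addnC.
by rewrite IH//; apply: cbuc_le bh; rewrite ltnS leq_addl.
Qed.

(** As the letters commute, the additional one can be moved next to [h]. *)
Lemma wirt_along_incr s c a l h : uniq s -> cbuc (\sum_(j <- s) a j).+1 h ->
  wirt_along s c (fun j => a j + (j == l))%N h =
  if l \in s then wirt_along s c a (wirt c l h) else wirt_along s c a h.
Proof.
elim: s => [|j s IH] //= /andP[js us]; rewrite big_cons => bh.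
have bs : cbuc (\sum_(j <- s) a j).+1 h by apply: cbuc_le bh; rewrite ltnS leq_addl.
rewrite IH// inE; have [jl|jl] := eqVneq j l.
  rewrite -jl (negPf js) addn1 iterSr /=.
  by rewrite wirt_wirt_along.
by rewrite addn0 /=; case: ifP.
Qed.

Definition multi_wirt c a h := wirt_along (enum 'I_n) c a h.

Lemma multi_wirt_incr c a l h : cbuc (multi_deg a).+1 h ->
  multi_wirt c (fun j => a j + (j == l))%N h = multi_wirt c a (wirt c l h).
Proof.
move=> bh; rewrite /multi_wirt wirt_along_incr ?enum_uniq ?mem_enum//.
by rewrite big_enum.
Qed.

Lemma multi_wirt0 c h : multi_wirt c (fun=> 0%N) h = h.
Proof. by rewrite /multi_wirt; elim: (enum _). Qed.

Lemma mwirtingerE a h : mwirtinger a h = multi_wirt (- 'i%C) a h.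
Proof.
rewrite /mwirtinger /multi_wirt /wirt_along; congr foldr.
by apply/funext => j; rewrite wirtingerE.
Qed.

Lemma mwirtinger_barE a h : mwirtinger_bar a h = multi_wirt 'i%C a h.
Proof.
rewrite /mwirtinger_bar /multi_wirt /wirt_along; congr foldr.
by apply/funext => j; rewrite wirtinger_barE.
Qed.

Lemma multi_deg_incr a l : multi_deg (fun j => a j + (j == l))%N = (multi_deg a).+1.
Proof.
rewrite /multi_deg big_split /= -[in RHS]addn1; congr addn.
by rewrite (bigD1 l)//= eqxx big1 ?addn0// => j /negPf ->.
Qed.

Lemma multi_fact_incr a l :
  multi_fact (fun j => a j + (j == l))%N = ((a l).+1 * multi_fact a)%N.
Proof.
rewrite /multi_fact (bigD1 l)//= [in RHS](bigD1 l)//= eqxx addn1 factS mulnA.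
by congr muln; apply: eq_bigr => j /negPf ->; rewrite addn0.
Qed.

Section Bounded.
Variable k : nat.
Local Notation A := {ffun 'I_n -> 'I_k.+1}.
Local Notation val_of al := (fun j => nat_of_ord (al j)).

(** If the entry is already [k], then [inord] falls back to 0; such entries are
    excluded in [ffun_incr_pred]. *)
Definition ffun_incr l (al : A) : A := [ffun j => inord (al j + (j == l))%N].

Definition ffun_decr l (al : A) : A := [ffun j => inord (al j - (j == l))%N].

Lemma ffun_incrE l (al : A) : (al l < k)%N ->
  val_of (ffun_incr l al) = (fun j => al j + (j == l))%N.
Proof.
move=> alk; apply/funext => j; rewrite ffunE inordK//.
by have [->|] := eqVneq j l; rewrite ?addn1 ?addn0.
Qed.

Lemma ffun_decrE l (al : A) : val_of (ffun_decr l al) = (fun j => al j - (j == l))%N.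
Proof.
apply/funext => j; rewrite ffunE inordK//.
exact: leq_ltn_trans (leq_subr _ _) (ltn_ord _).
Qed.

Lemma ffun_incrK l (al : A) : (al l < k)%N -> ffun_decr l (ffun_incr l al) = al.
Proof.
move=> alk; apply/ffunP => j; apply: val_inj.
have := congr1 (@^~ j) (ffun_decrE l (ffun_incr l al)) => /= ->.
by have := congr1 (@^~ j) (ffun_incrE alk) => /= ->; rewrite addnK.
Qed.

Lemma ffun_decrK l (al : A) : (0 < al l)%N -> ffun_incr l (ffun_decr l al) = al.
Proof.
move=> al0; have E := congr1 (@^~ l) (ffun_decrE l al).
have alk : (ffun_decr l al l < k)%N.
  by rewrite /= in E; rewrite E eqxx subn1 prednK// -ltnS.
apply/ffunP => j; apply: val_inj.
have := congr1 (@^~ j) (ffun_incrE alk) => /= ->.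
have := congr1 (@^~ j) (ffun_decrE l al) => /= ->.
by have [->|] := eqVneq j l; rewrite ?subnK// subn0 addn0.
Qed.

Lemma ffun_incr_pred i l (al : A) : (i < k)%N ->
  ((multi_deg (val_of (ffun_incr l al)) == i.+1) && (0 < ffun_incr l al l)%N) &&
    (ffun_decr l (ffun_incr l al) == al) = (multi_deg (val_of al) == i).
Proof.
move=> ik; have [alk|] := ltnP (al l) k.
  rewrite ffun_incrK// eqxx andbT ffun_incrE// multi_deg_incr eqSS.
  have := congr1 (@^~ l) (ffun_incrE alk) => /= ->.
  by rewrite eqxx addn1 andbT.
move=> kal; have -> : (0 < ffun_incr l al l)%N = false.
  rewrite ffunE eqxx addn1 /inord val_insubd ltnS.
  by case: ifP => //; rewrite ltnNge kal.
rewrite andbF /=; apply/esym/negP => /eqP degi.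
have : (al l <= multi_deg (val_of al))%N by rewrite /multi_deg (bigD1 l)//= leq_addr.
by rewrite degi leqNgt (leq_trans ik kal).
Qed.

Definition deg_sum c c' X i f g : C :=
  \sum_(al : A | multi_deg (val_of al) == i)
    (multi_fact (val_of al))%:R^-1 * X (multi_wirt c (val_of al) f)
                                       (multi_wirt c' (val_of al) g).

(** Weighting each multi-index of degree i+1 by its entries, which add up to
    i+1, and removing one unit from the corresponding entry reproduces the
    recursion of the sum over words. *)
Lemma deg_sumS c c' X i f g : (i < k)%N -> cbuc i.+1 f -> cbuc i.+1 g ->
  i.+1%:R * deg_sum c c' X i.+1 f g =
  \sum_(l < n) deg_sum c c' X i (wirt c l f) (wirt c' l g).
Proof.
move=> ik bf bg; rewrite /deg_sum mulr_sumr.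
pose W a := X (multi_wirt c a f) (multi_wirt c' a g).
transitivity (\sum_(al : A | multi_deg (val_of al) == i.+1)
    \sum_(l < n) (al l)%:R * ((multi_fact (val_of al))%:R^-1 * W (val_of al))).
  apply: eq_bigr => al /eqP <-.
  by rewrite -mulr_suml -natr_sum.
rewrite exchange_big; apply: eq_bigr => l _ /=.
rewrite (bigID (fun al : A => 0 < al l)%N)/= [X in _ + X]big1 ?addr0; last first.
  by move=> al /andP[_]; rewrite -eqn0Ngt => /eqP ->; rewrite mul0r.
rewrite (reindex_onto (ffun_incr l) (ffun_decr l)); last first.
  by move=> al /andP[_]; exact: ffun_decrK.
rewrite (eq_bigl _ _ (fun al => ffun_incr_pred l al ik)).
apply: eq_bigr => al /eqP degi.
have alk : (al l < k)%N.
  by apply: leq_ltn_trans ik; rewrite -degi /multi_deg (bigD1 l)//= leq_addr.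
have al1 := congr1 (@^~ l) (ffun_incrE alk); rewrite /= eqxx addn1 in al1.
rewrite al1 ffun_incrE// multi_fact_incr /W.
by rewrite !multi_wirt_incr ?degi// natrM invfM mulrA mulrA mulfV ?mul1r.
Qed.

Lemma deg_sumE c c' X i f g : (i <= k)%N -> cbuc i f -> cbuc i g ->
  deg_sum c c' X i f g = (i`!)%:R^-1 * word_sum c c' X i f g.
Proof.
elim: i f g => [|i IH] f g ik bf bg.
  rewrite fact0 invr1 mul1r /= /deg_sum (big_pred1 [ffun=> ord0]).
    have -> : val_of ([ffun=> ord0] : A) = fun=> 0%N by apply/funext => j; rewrite ffunE.
    rewrite !multi_wirt0 /multi_fact big1 ?invr1 ?mul1r//.
  move=> al; apply/eqP/eqP => [deg0|-> /=]; last first.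
    by rewrite /multi_deg big1// => j _; rewrite ffunE.
  apply/ffunP => j; apply: val_inj; rewrite ffunE /=.
  by apply/eqP; rewrite -leqn0 -deg0 /multi_deg (bigD1 j)//= leq_addr.
have i1 : i.+1%:R != 0 :> C by rewrite pnatr_eq0.
apply: (mulfI i1); rewrite deg_sumS//= factS natrM invfM.
rewrite mulrA mulrA mulfV// mul1r mulr_sumr; apply: eq_bigr => l _.
by apply: IH; [exact: ltnW|exact: cbuc_wirt|exact: cbuc_wirt].
Qed.

Lemma multi_sum_deg (F : ('I_n -> nat) -> C) :
  multi_sum k F = \sum_(i < k.+1) \sum_(al : A | multi_deg (val_of al) == i) F (val_of al).
Proof.
rewrite /multi_sum.
rewrite (partition_big (fun al : A => inord (multi_deg (val_of al)) : 'I_k.+1) xpredT)//=.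
apply: eq_bigr => i _; apply: eq_bigl => al.
have [dk|dk] := leqP (multi_deg (val_of al)) k.
  by rewrite -val_eqE /= inordK.
rewrite andFb; apply/esym/negP => /eqP di; move: dk.
by rewrite di ltnNge -ltnS ltn_ord.
Qed.

(** Exactly i! / a! words of length i have the letter counts a. *)
Lemma multi_sum_word c c' X (x t : R) f g : cbuc k f -> cbuc k g ->
  multi_sum k (fun a => ((x * t) ^+ multi_deg a / (multi_fact a)%:R)%:C *
    X (multi_wirt c a f) (multi_wirt c' a g)) =
  \sum_(i < k.+1) exp_coef x t i * word_sum c c' X i f g.
Proof.
move=> bf bg; rewrite multi_sum_deg; apply: eq_bigr => i _.
have ik : (i <= k)%N by rewrite -ltnS.
have bfi : cbuc i f by apply: cbuc_le bf.
have bgi : cbuc i g by apply: cbuc_le bg.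
rewrite /exp_coef (rmorphM (real_complex R)) /= (fmorphV (real_complex R)) rmorph_nat.
rewrite -mulrA -deg_sumE// mulr_sumr; apply: eq_bigr => al /eqP ->.
by rewrite (rmorphM (real_complex R)) /= (fmorphV (real_complex R)) rmorph_nat mulrA.
Qed.

End Bounded.

End MultiIndexSums.

(** * The supremum *)

Section Assembly.
Context {R : realType} {n : nat}.
Local Notation C := R[i].
Local Notation Cn := 'rV[R[i]]_n.
Implicit Types (f g h : Cn -> C) (z : Cn) (a : 'I_n -> nat) (c : C) (t : R).

Lemma wirt_along_cplx_heat s c a t h : cbuc (\sum_(j <- s) a j) h ->
  wirt_along s c a (cplx_heat t h) = cplx_heat t (wirt_along s c a h).
Proof.
elim: s => [|j s IH] //=; rewrite big_cons => bh.
rewrite IH; last by apply: cbuc_le bh; rewrite leq_addl.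
have : cbuc (a j) (wirt_along s c a h) by apply: cbuc_wirt_along; rewrite addnC.
elim: (a j) => //= m IHm bm; rewrite IHm; last exact: cbucW.
by apply: (@cplx_heat_wirt _ _ 0); apply: cbuc_iter_wirt; rewrite addn1.
Qed.

Lemma multi_wirt_cplx_heat c a t h : cbuc (multi_deg a) h ->
  multi_wirt c a (cplx_heat t h) = cplx_heat t (multi_wirt c a h).
Proof. by move=> bh; apply: wirt_along_cplx_heat; rewrite big_enum. Qed.

Lemma cbuc0_multi_wirt c a k h : (multi_deg a <= k)%N -> cbuc k h ->
  cbuc 0 (multi_wirt c a h).
Proof.
move=> ak bh; apply: cbuc_wirt_along; rewrite addn0 big_enum; exact: cbuc_le bh.
Qed.

Lemma eq_multi_sum k (F G : ('I_n -> nat) -> C) :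
  (forall a, (multi_deg a <= k)%N -> F a = G a) -> multi_sum k F = multi_sum k G.
Proof. by move=> FG; apply: eq_bigr => al; exact: FG. Qed.

Lemma multi_sum_heat_of_product k t z f g : 0 < t -> cbuc k f -> cbuc k g ->
  multi_sum k (fun a => ((- t) ^+ multi_deg a / (multi_fact a)%:R)%:C *
    heat_transform t (fun w => mwirtinger a f w * mwirtinger_bar a g w) z) =
  F_sum k t z f g.
Proof.
move=> t0 bf bg; rewrite /F_sum /F_word -multi_sum_word//.
apply: eq_multi_sum => a ak; rewrite mulN1r mwirtingerE mwirtinger_barE.
rewrite heat_transform_cplx_heat//; apply: cbucM; exact: cbuc0_multi_wirt ak _.
Qed.

Lemma multi_sum_product_of_heats k t z f g : 0 < t -> cbuc k f -> cbuc k g ->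
  multi_sum k (fun a => (t ^+ multi_deg a / (multi_fact a)%:R)%:C *
    (mwirtinger_bar a (heat_transform t f) z *
     mwirtinger a (heat_transform t g) z)) =
  G_sum k t z f g.
Proof.
move=> t0 bf bg; rewrite /G_sum /G_word -multi_sum_word//.
apply: eq_multi_sum => a ak; rewrite mul1r mwirtingerE mwirtinger_barE.
rewrite (heat_transform_cplx_heat t0 (cbuc0 bf)) (heat_transform_cplx_heat t0 (cbuc0 bg)).
by rewrite !multi_wirt_cplx_heat//; apply: cbuc_le ak _.
Qed.

Lemma cvg_ereal_sup_littleo k (r : R -> Cn -> C) : unif_littleo k r ->
  (fun t : R => ((t ^- k)%:E *
     ereal_sup (range (fun z : Cn => (Normc.normc (r t z))%:E)))%E)
    @ 0^'+ --> (0%E : \bar R).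
Proof.
move=> ro.
have bound e : 0 < e -> exists2 T : R, 0 < T & forall t, 0 < t < T ->
    exists2 x : R, 0 <= x <= e &
    ((t ^- k)%:E * ereal_sup (range (fun z : Cn => (Normc.normc (r t z))%:E)))%E = x%:E.
  move=> e0; have [T T0 H] := ro e e0; exists T => // t tT.
  have t0 : 0 < t by case/andP: tT.
  set S := ereal_sup _.
  have S0 : (0%:E <= S)%E.
    apply: (@le_trans _ _ (Normc.normc (r t 0))%:E); first by rewrite lee_fin normc_ge0.
    by apply: ereal_sup_ubound; exists 0.
  have Se : (S <= (e * t ^+ k)%:E)%E.
    by apply: ge_ereal_sup => _ [z _ <-]; rewrite lee_fin; exact: H.
  have Sfin : S \is a fin_num.
    by rewrite ge0_fin_numE// (le_lt_trans Se)// ltry.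
  rewrite -(fineK Sfin) in S0 Se *; rewrite !lee_fin in S0 Se.
  exists (t ^- k * fine S); last by rewrite EFinM.
  rewrite mulr_ge0 ?invr_ge0 ?exprn_ge0 ?(ltW t0)//=.
  by rewrite mulrC ler_pdivrMr ?exprn_gt0.
apply/fine_cvgP; split.
  have [T T0 H] := bound 1 ltr01; near=> t.
  have [|x _ ->] := H t; last by [].
  by apply/andP; split; near: t; [exact: nbhs_right_gt|exact: nbhs_right_lt].
apply/cvgrPdist_le => e e0; have [T T0 H] := bound e e0; near=> t.
have [|x /andP[x0 xe] E] := H t.
  by apply/andP; split; near: t; [exact: nbhs_right_gt|exact: nbhs_right_lt].
by rewrite /= E /= sub0r normrN ger0_norm.
Unshelve. all: by end_near. Qed.

End Assembly.

Theorem theorem3 (R : realType) (n k : nat) (f g : 'rV[R[i]]_n -> R[i])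
    (hn : (1 <= n)%N) (hf : C_buc (2 * k) f) (hg : C_buc (2 * k) g) :
  (fun t : R =>
     ((t ^- k)%:E * ereal_sup (range (fun z : 'rV[R[i]]_n =>
       (Normc.normc
         (multi_sum k (fun a =>
            ((- t) ^+ multi_deg a / (multi_fact a)%:R)%:C *
            heat_transform t
              (fun w => mwirtinger a f w * mwirtinger_bar a g w) z)
          - multi_sum k (fun a =>
              (t ^+ multi_deg a / (multi_fact a)%:R)%:C *
              (mwirtinger_bar a (heat_transform t f) z *
               mwirtinger a (heat_transform t g) z))))%:E)))%E)
    @ 0^'+ --> (0%E : \bar R).
Proof.
have bf : cbuc (2 * k) f by exact: C_buc_cbuc.
have bg : cbuc (2 * k) g by exact: C_buc_cbuc.
have k2 : (k <= 2 * k)%N by lia.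
apply: cvg_ereal_sup_littleo; apply: unif_littleo_ext (defect_littleo bf bg) => t z t0.
rewrite multi_sum_heat_of_product ?multi_sum_product_of_heats//; exact: cbuc_le k2 _.
Qed.
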